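(* Let $\Bbbk$ be an algebraically closed field of characteristic zero, and let $\Delta$ be an oriented $n$-dimensional pseudomanifold on $d$ vertices, with top homology class $H_n(\Delta)$. Then there exists a (projective) toric variety $X=V(I)$ of dimension $d$, where $I=I_{\mathcal A}\subseteq S$ is a homogeneous toric ideal, such that $I$ has a minimal linear $n$-th syzygy of rank $d$. Moreover, if $\mathbf m$ is the multidegree of this syzygy, then the simplicial complex $\Delta_{\mathbf m}=\Delta_{\mathbf m}(\mathcal A)$ which computes $\mathrm{Tor}_n^S(I,\Bbbk)_{\mathbf m}$ is homotopy equivalent to $\Delta$.
   Context: Oriented pseudomanifold: an oriented pseudomanifold $\Delta$ of dimension $n$ on $d$ vertices consists of a set of oriented $(n+1)$-subsets of $\{1,\dots,d\}$ (the $n$-faces; $\Delta$ also denotes the simplicial complex they generate, with vertex set $\{1,\dots,d\}$) such that (1) each $n$-subset of $\{1,\dots,d\}$ is contained in exactly zero or two elements of $\Delta$, and in the latter case the induced orientations cancel; (2) $\Delta$ is strongly connected: the graph with one vertex for each $n$-face, and an edge between two $n$-faces sharing an $(n-1)$-face, is connected. The top homology class is the class in $H_n(\Delta)$ given by the sum of the oriented $n$-faces. Toric ideals: for a finite set $\mathcal A=\{\mathbf a_1,\dots,\mathbf a_q\}\subseteq\mathbb Z^p$, with $A$ the matrix having columns $\mathbf a_i$, $I_{\mathcal A}=\langle x^{\alpha}-x^{\beta}\mid \alpha,\beta\in\mathbb N^q,\ \alpha-\beta\in\ker A\rangle\subseteq S=\Bbbk[x_1,\dots,x_q]$; it is $\mathbb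 Z^p$-graded by $\deg x_i=\mathbf a_i$. For $\mathbf m\in\mathbb Z^p$, $\Delta_{\mathbf m}(\mathcal A)=\{J\subseteq\{1,\dots,q\}\mid \mathbf m-\sum_{i\in J}\mathbf a_i\in\mathbb N\mathcal A\}$, where $\mathbb N\mathcal A$ is the semigroup generated by $\mathcal A$ (including $0$). By a result of Hochster, $\widetilde H_j(\Delta_{\mathbf m}(\mathcal A),\Bbbk)\cong \mathrm{Tor}_j^S(I_{\mathcal A},\Bbbk)_{\mathbf m}$. Linear syzygies and rank: with $S$ standard graded and $I$ homogeneous, let $b_{i,j}=\dim_\Bbbk\mathrm{Tor}^S_i(S/I,\Bbbk)_j$ and let $$0\leftarrow S/\langle I_2\rangle\leftarrow S\leftarrow F_1\otimes S(-2)\leftarrow F_2\otimes S(-3)\leftarrow F_3\otimes S(-4)\leftarrow\cdots$$ be the 2-linear strand of the minimal free resolution of $S/I$, where $F_i$ is a vector space of dimension $b_{i,i+1}$. A (minimal) linear $n$-th syzygy is a nonzero element $f\in F_{n+1}$. Its rank is the dimension of the smallest vector subspace $G\subseteq F_n$ such that the differential $F_{n+1}\otimes S(-n-2)\to F_n\otimes S(-n-1)$ maps $f\otimes S(-n-2)$ into $G\otimes S(-n-1)$. *)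

(* Defs.v *)
From mathcomp Require Export all_boot all_order all_algebra.
From mathcomp Require Export all_classical all_reals all_analysis.
(* The notations of multinomials clash with those of MathComp-Analysis. *)
From mathcomp Require Export -(notations) mpoly.

Set Implicit Arguments.
Unset Strict Implicit.
Unset Printing Implicit Defensive.

Import Order.TTheory GRing.Theory Num.Theory.
Import numFieldNormedType.Exports.

Local Open Scope ring_scope.
Local Open Scope classical_set_scope.

Notation "{ 'mpoly' T [ n ] }" := (mpoly n T)
  (at level 0, T, n at level 2, format "{ 'mpoly'  T [ n ] }").

(* An orientation of a face [s] is recorded by a boolean: it is [true] iff the
   chosen orientation is opposite to the one given by listing the elements of
   [s] in increasing order.  [induced_sign o s v] is the sign, again relative
   to the increasing order, of the orientation induced on the face [s :\ v]:
   the coefficient of [s :\ v] in the simplicial boundary of oriented [s]. *)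
Definition induced_sign (d : nat) (o : {set 'I_d} -> bool) (s : {set 'I_d})
    (v : 'I_d) : int :=
  (-1) ^+ (o s) * (-1) ^+ #|[set u in s | (u < v)%N]%SET|.

Definition share_ridge (n d : nat) (F : {set {set 'I_d}}) : rel {set 'I_d} :=
  fun s t => [&& s \in F, t \in F & #|s :&: t| == n].

(* The vertex set of the complex generated by the facets is the whole of
   ['I_d] ([pm_cover]), and a connected graph is nonempty ([pm_nonempty]). *)
Record oriented_pseudomanifold (n d : nat) := OrientedPseudomanifold {
  pm_facets : {set {set 'I_d}};
  pm_orient : {set 'I_d} -> bool;
  pm_card : forall s, s \in pm_facets -> #|s| = n.+1;
  pm_cover : forall v, exists2 s, s \in pm_facets & v \in s;
  pm_ridge : forall t : {set 'I_d}, #|t| = n ->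
    #|[set s in pm_facets | t \subset s]%SET| = 0%N \/
    #|[set s in pm_facets | t \subset s]%SET| = 2%N;
  pm_cancel : forall (t : {set 'I_d}) (v w : 'I_d), #|t| = n -> v != w ->
    v \notin t -> w \notin t -> v |: t \in pm_facets -> w |: t \in pm_facets ->
    induced_sign pm_orient (v |: t) v + induced_sign pm_orient (w |: t) w = 0;
  pm_nonempty : pm_facets != finset.set0;
  pm_connected : forall s t, s \in pm_facets -> t \in pm_facets ->
    connect (share_ridge n pm_facets) s t
}.

Definition pm_complex (n d : nat) (D : oriented_pseudomanifold n d) :
    set {set 'I_d} :=
  [set s | exists2 t, t \in pm_facets D & s \subset t].

Definition realization (R : realType) (q : nat) (K : set {set 'I_q}) :
    set 'rV[R]_q :=
  [set x | [/\ forall i, 0 <= x ord0 i, \sum_i x ord0 i = 1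
             & K [set i | x ord0 i != 0]%SET]].
Arguments realization R [q] K.

Definition homotopic_to_id (R : realType) (T : topologicalType) (X : set T)
    (h : T -> T) : Prop :=
  exists H : R * T -> T,
    [/\ {within `[0, 1] `*` X, continuous H},
        forall t x, `[0, 1] t -> X x -> X (H (t, x)),
        forall x, X x -> H (0, x) = h x
      & forall x, X x -> H (1, x) = x].

Definition homotopy_equivalent (R : realType) (T U : topologicalType)
    (X : set T) (Y : set U) : Prop :=
  exists (f : T -> U) (g : U -> T),
    [/\ {within X, continuous f} /\ {homo f : x / X x >-> Y x},
        {within Y, continuous g} /\ {homo g : y / Y y >-> X y},
        homotopic_to_id R X (g \o f)
      & homotopic_to_id R Y (f \o g)].

Definition complexes_homotopy_equivalent (R : realType) (q r : nat)
    (K : set {set 'I_q}) (L : set {set 'I_r}) : Prop :=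
  homotopy_equivalent R (realization R K) (realization R L).

Definition ideal_generated (S : comNzRingType) (E : set S) : set S :=
  [set f | exists s : seq (S * S),
     (forall x, x \in s -> E x.2) /\ f = \sum_(x <- s) x.1 * x.2].

Section Toric.
Variables (p q : nat) (A : 'M[int]_(p, q)).

(* The degree of the monomial with exponent vector [u] when the [j]-th variable
   has degree [col j A]. *)
Definition mono_multidegree (u : multinom q) : 'cV[int]_p :=
  A *m \col_j (u j)%:Z.

Definition toric_ideal (k : fieldType) : set {mpoly k[q]} :=
  ideal_generated [set f | exists u v : multinom q,
    A *m \col_j ((u j)%:Z - (v j)%:Z) = 0 /\ f = mpolyX k u - mpolyX k v].

Definition toric_semigroup : set 'cV[int]_p := range mono_multidegree.

Definition degree_complex (m : 'cV[int]_p) : set {set 'I_q} :=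
  [set J : {set 'I_q} | toric_semigroup (m - \sum_(i in J) col i A)].

End Toric.
Arguments toric_ideal [p q] A k.

Definition homogeneous_ideal (k : fieldType) (q : nat) (I : set {mpoly k[q]}) :
    Prop :=
  forall f e, I f -> I (pihomog mdeg e f).

(* A subset of projective space is represented by the set of all the
   homogeneous coordinate vectors (hence nonzero vectors) of its points. *)
Section Projective.
Variables (k : fieldType) (q : nat).

Definition proj_zeros (E : set {mpoly k[q]}) : set ('I_q -> k) :=
  [set x | (exists i, x i != 0) /\ forall f, E f -> meval x f = 0].

Definition proj_closed (Z : set ('I_q -> k)) : Prop :=
  exists E : set {mpoly k[q]},
    (forall f, E f -> exists e, f \is ishomog1 e mdeg) /\ Z = proj_zeros E.

Definition proj_irreducible (Z : set ('I_q -> k)) : Prop :=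
  Z !=set0 /\ forall Z1 Z2, proj_closed Z1 -> proj_closed Z2 ->
    Z `<=` Z1 `|` Z2 -> Z `<=` Z1 \/ Z `<=` Z2.

Definition irreducible_chain (X : set ('I_q -> k)) (r : nat)
    (Z : nat -> set ('I_q -> k)) : Prop :=
  (forall i, (i <= r)%N ->
     [/\ proj_closed (Z i), proj_irreducible (Z i) & Z i `<=` X]) /\
  (forall i, (i < r)%N -> Z i `<` Z i.+1).

Definition proj_dimension (X : set ('I_q -> k)) (d : nat) : Prop :=
  (exists Z, irreducible_chain X d Z) /\
  (forall r Z, irreducible_chain X r Z -> (r <= d)%N).

End Projective.

(* A sequence of finite free S-modules G_i with basis elements having both a
   standard degree and a multidegree.  Elements of G_i are row vectors, and the
   differential G_(i+1) -> G_i is [fun v => v *m fr_diff G i]. *)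
Record free_sequence (k : fieldType) (p q : nat) := FreeSequence {
  fr_rank : nat -> nat;
  fr_deg : forall i, 'I_(fr_rank i) -> nat;
  fr_multideg : forall i, 'I_(fr_rank i) -> 'cV[int]_p;
  fr_diff : forall i, 'M[{mpoly k[q]}]_(fr_rank i.+1, fr_rank i)
}.

(* G is a minimal graded free resolution of S / I_A, with G_0 = S.  Since G_0
   has rank 1, [const_mx f] is the element f of G_0. *)
Record minimal_resolution (k : fieldType) (p q : nat) (A : 'M[int]_(p, q))
    (G : free_sequence k p q) : Prop := MinimalResolution {
  mr_rank0 : fr_rank G 0 = 1%N;
  mr_deg0 : forall b : 'I_(fr_rank G 0), fr_deg b = 0%N /\ fr_multideg b = 0;
  mr_graded : forall i a b u, u \in msupp (fr_diff G i a b) ->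
    fr_deg a = (mdeg u + fr_deg b)%N /\
    fr_multideg a = mono_multidegree A u + fr_multideg b;
  mr_coker : forall f, toric_ideal A k f <->
    exists v : 'rV_(fr_rank G 1), v *m fr_diff G 0 = const_mx f;
  mr_exact : forall i (v : 'rV_(fr_rank G i.+1)), v *m fr_diff G i = 0 <->
    exists w : 'rV_(fr_rank G i.+2), v = w *m fr_diff G i.+1;
  mr_minimal : forall i a b, mcoeff (@mnm0 q) (fr_diff G i a b) = 0
}.

Section LinearStrand.
Variables (k : fieldType) (p q : nat) (G : free_sequence k p q).

(* The vector space F_i of the 2-linear strand, i >= 1, as the k-span inside
   G_i of the basis elements of standard degree i + 1. *)
Definition strand (i : nat) : {vspace 'rV[k]_(fr_rank G i)} :=
  (\sum_(a < fr_rank G i | fr_deg a == i.+1) <[delta_mx ord0 a]>)%VS.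

Definition strand_diff (i : nat) (f : 'rV[k]_(fr_rank G i.+1)) :
    'rV[{mpoly k[q]}]_(fr_rank G i) :=
  map_mx (@mpolyC q k) f *m fr_diff G i.

(* [w] lies in V (x) S: the coefficient of each monomial of [w], a vector with
   entries in k, lies in V. *)
Definition in_tensor (r : nat) (V : {vspace 'rV[k]_r})
    (w : 'rV[{mpoly k[q]}]_r) : Prop :=
  forall u : multinom q, map_mx (mcoeff u) w \in V.

Definition linear_syzygy (n : nat) (f : 'rV[k]_(fr_rank G n.+1)) : Prop :=
  f != 0 /\ f \in strand n.+1.

(* The smallest W <= F_n such that f is mapped into W (x) S(-n-1) has
   dimension r. *)
Definition syzygy_rank (n : nat) (f : 'rV[k]_(fr_rank G n.+1)) (r : nat) :
    Prop :=
  exists W : {vspace 'rV[k]_(fr_rank G n)},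
    [/\ (W <= strand n)%VS, in_tensor W (strand_diff f),
        forall W' : {vspace 'rV[k]_(fr_rank G n)}, (W' <= strand n)%VS ->
          in_tensor W' (strand_diff f) -> (W <= W')%VS
      & \dim W = r].

Definition has_multidegree (i : nat) (f : 'rV[k]_(fr_rank G i))
    (m : 'cV[int]_p) : Prop :=
  forall a, f ord0 a != 0 -> fr_multideg a = m.

End LinearStrand.

(* I_A has a minimal linear n-th syzygy of rank r and multidegree m.  The
   minimal free resolution is unique only up to isomorphism, so the statement
   is made for all of them, together with existence. *)
Definition has_linear_syzygy (k : fieldType) (p q : nat) (A : 'M[int]_(p, q))
    (n r : nat) (m : 'cV[int]_p) : Prop :=
  (exists G : free_sequence k p q, minimal_resolution A G) /\
  forall G : free_sequence k p q, minimal_resolution A G ->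
    exists f : 'rV[k]_(fr_rank G n.+1),
      [/\ linear_syzygy f, syzygy_rank f r & has_multidegree f m].

(* Main.v *)
From HB Require Import structures.
Require Import Defs.
From mathcomp Require Import zify.
Set Implicit Arguments.
Unset Strict Implicit.
Unset Printing Implicit Defensive.

Import Order.TTheory GRing.Theory Num.Theory.
Import numFieldNormedType.Exports.
Local Open Scope ring_scope.
Local Open Scope classical_set_scope.

(** Let x_i be a variable for each vertex i of Delta and z_s one for each facet
    s, with multidegrees deg x_i = e_i and deg z_s = e_0 + (sum of the e_b for b
    not in s). Then every z_s times the product of the x_i, i in s, has the same
    multidegree m = (1, ..., 1), and these are the only monomials of degree m
    ([degree_complexP]). A suitable linear functional takes the value 1 on all
    the degrees, so the toric ideal I is homogeneous; it is the kernel of a map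
    of polynomial rings ([toric_idealP]).

    Dimension. Inside X = V(I), the points with all z_s = 0 form a projective
    space of dimension d - 1, whose coordinate subspaces followed by X give a
    chain of length d. Conversely a chain of length r provides r + 1 forms that
    are algebraically independent on X ([chain_independent]); counting the
    monomials in them against the multidegrees of a given degree, which form a
    set of polynomial growth of order d, gives r <= d ([toric_chain_length]).

    Minimal resolutions exist because submodules of free modules over the
    polynomial ring are finitely generated ([submodule_fg], from Dickson's
    lemma) and a shortest homogeneous generating system has no relation with a
    unit coefficient ([minimal_generators]).

    The syzygy. Let G be any minimal resolution. The element sum of the
    +- z_s e_s, over the facets s, of the exterior algebra on the e_i with
    coefficients in G_0 has Koszul boundary in I, because Delta is an oriented
    pseudomanifold ([cycle_boundary_toric]). Lifting it step by step along G
    ([zigzag]) ends after n + 1 steps in an element f of G_(n+1) of degree m.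
    Since the generators of G_i, i > 0, have degree at least i + 1, the lifts
    have constant coefficients, and the differential of f is the sum of the x_j c_j,
    where c_j is the coefficient of e_j in the n-th lift. The c_j have distinct
    multidegrees, and none is zero: otherwise all the lifts would vanish on the
    faces containing j, down to the Koszul boundary of the initial element
    ([zigzag_vertex_neq0]). So the rank of f is the number d of vertices.

    Homotopy type. The complex of m is Delta with a cone of apex z_s glued on
    each facet s. Spreading the weight of z_s uniformly over the vertices of s
    is a retraction onto Delta, homotopic to the identity along segments. *)

(** * Selecting the monomials of a polynomial *)

Section MonomialFilter.
Variables (k : fieldType) (q : nat).
Implicit Types (f g : {mpoly k[q]}) (P : multinom q -> bool).

Definition mfilter P f : {mpoly k[q]} :=
  \sum_(u <- msupp f | P u) mcoeff u f *: mpolyX k u.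

Lemma mcoeff_mfilter P f u :
  mcoeff u (mfilter P f) = if P u then mcoeff u f else 0.
Proof.
rewrite /mfilter raddf_sum /=.
under eq_bigr do rewrite mcoeffZ mcoeffX.
have [uf|uf] := boolP (u \in msupp f); last first.
  rewrite memN_msupp_eq0 // if_same big_seq_cond big1 // => v /andP[vf _].
  by case: eqP => [vu|]; [rewrite -vu vf in uf | rewrite mulr0].
case: ifPn => Pu.
  rewrite (big_rem u) //= Pu eqxx mulr1 big_seq_cond big1 ?addr0 // => v /andP[+ _].
  rewrite mem_rem_uniq ?msupp_uniq // inE => /andP[/negPf->].
  by rewrite mulr0.
rewrite big1 // => v Pv; case: eqP => [vu|]; last by rewrite mulr0.
by rewrite -vu Pv in Pu.
Qed.

Lemma mfilter_is_linear P : linear (mfilter P).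
Proof.
move=> c f g; apply/mpolyP => u.
rewrite mcoeffD mcoeffZ !mcoeff_mfilter mcoeffD mcoeffZ.
by case: ifP; rewrite ?mulr0 ?addr0.
Qed.

HB.instance Definition _ P :=
  GRing.isLinear.Build k {mpoly k[q]} {mpoly k[q]} _ (mfilter P)
    (mfilter_is_linear P).

Lemma mcoeff_pihomog e u f :
  mcoeff u (pihomog mdeg e f) = if mdeg u == e then mcoeff u f else 0.
Proof.
rewrite -(mcoeff_mfilter (fun u => mdeg u == e)); congr (mcoeff _ _).
Qed.

End MonomialFilter.

(** * Toric ideals as kernels *)

Section ToricKernel.
Variables (k : fieldType) (p q : nat) (e : 'I_q -> multinom p).
Implicit Types (f g : {mpoly k[q]}) (u v : multinom q).

(** Nonnegative entries suffice here; they make the multidegrees of monomials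
    exponents of monomials in p parameters, and the toric ideal the kernel of
    a morphism between polynomial rings. *)
Definition exponent_mx : 'M[int]_(p, q) := \matrix_(a, j) (e j a)%:Z.

Definition mono_image u : multinom p :=
  Multinom [tuple (\sum_(j < q) u j * e j a)%N | a < p].

Definition toric_map : {mpoly k[q]} -> {mpoly k[p]} :=
  mmap (@mpolyC p k) (fun j => mpolyX k (e j)).
HB.instance Definition _ := GRing.RMorphism.on toric_map.

Lemma toric_mapX u : toric_map (mpolyX k u) = mpolyX k (mono_image u).
Proof.
rewrite /toric_map mmapX /mmap1.
under eq_bigr do rewrite mpolyXn.
rewrite mprodXE; congr mpolyX.
apply/mnmP => a; rewrite mnm_sumE mnmE.
by apply: eq_bigr => j _; rewrite mulmnE mulnC.
Qed.

Lemma toric_mapZ c f : toric_map (c *: f) = c *: toric_map f.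
Proof. by rewrite /toric_map mmapZ mul_mpolyC. Qed.

Lemma toric_mapE f : toric_map f =
  \sum_(u <- msupp f) mcoeff u f *: mpolyX k (mono_image u).
Proof.
rewrite [in LHS](mpolyE f) raddf_sum; apply: eq_bigr => u _ /=.
by rewrite -toric_mapX -toric_mapZ.
Qed.

Lemma mcoeff_toric_map f w :
  mcoeff w (toric_map f) = \sum_(u <- msupp f | mono_image u == w) mcoeff u f.
Proof.
rewrite toric_mapE raddf_sum big_mkcond [RHS]big_mkcond /=.
apply: eq_bigr => u _; rewrite mcoeffZ mcoeffX.
by case: eqP; rewrite ?mulr1 ?mulr0.
Qed.

Lemma mono_multidegreeE u a :
  mono_multidegree exponent_mx u a ord0 = (mono_image u a)%:Z.
Proof.
rewrite !mxE mnmE; under eq_bigr do rewrite !mxE.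
rewrite (raddf_sum Posz) /=; apply: eq_bigr => j _.
by rewrite mulrC -PoszM.
Qed.

Lemma mono_multidegree_eq u v :
  (mono_multidegree exponent_mx u = mono_multidegree exponent_mx v) <->
  (mono_image u = mono_image v).
Proof.
split=> [uv|uv].
  apply/mnmP => a; move/matrixP/(_ a ord0): uv; rewrite !mono_multidegreeE.
  by move=> [].
by apply/matrixP => a b; rewrite !ord1 !mono_multidegreeE uv.
Qed.

Lemma exponent_mx_kernel u v :
  exponent_mx *m \col_j ((u j)%:Z - (v j)%:Z) = 0 <->
  mono_image u = mono_image v.
Proof.
rewrite -mono_multidegree_eq /mono_multidegree.
have -> : \col_j ((u j)%:Z - (v j)%:Z) = \col_j (u j)%:Z - \col_j (v j)%:Z.
  by apply/matrixP => a b; rewrite !mxE.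
rewrite mulmxBr; split=> [/eqP|->]; last by rewrite subrr.
by rewrite subr_eq0 => /eqP.
Qed.

(** Choose one monomial in each multidegree. Modulo the binomials, f is the
    combination of the chosen monomials whose coefficients are those of
    [toric_map f]. *)
Lemma toric_idealP f : toric_ideal exponent_mx k f <-> toric_map f = 0.
Proof.
split=> [[s [sE ->]]|f0].
  rewrite raddf_sum /= big_seq big1 // => x /sE [u [v [/exponent_mx_kernel uv ->]]].
  by rewrite rmorphM raddfB /= !toric_mapX uv subrr mulr0.
pose rho w : multinom q := xget (@mnm0 q) [set u | mono_image u = w].
have rhoP u : mono_image (rho (mono_image u)) = mono_image u.
  by have := @xgetPex _ (@mnm0 q) [set u0 | mono_image u0 = mono_image u]; apply; exists u.
exists [seq (mpolyC q (mcoeff u f), mpolyX k u - mpolyX k (rho (mono_image u)))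
       | u <- msupp f]; split.
  move=> _ /mapP[u _ ->] /=; exists u, (rho (mono_image u)); split=> //.
  by apply/exponent_mx_kernel; rewrite rhoP.
rewrite big_map /=; under eq_bigr do rewrite mul_mpolyC scalerBr.
rewrite sumrB -mpolyE.
suff -> : \sum_(u <- msupp f) mcoeff u f *: mpolyX k (rho (mono_image u)) = 0.
  by rewrite subr0.
pose L := undup [seq mono_image u | u <- msupp f].
transitivity (\sum_(w <- L) mcoeff w (toric_map f) *: mpolyX k (rho w)).
  under [RHS]eq_bigr do rewrite mcoeff_toric_map scaler_suml big_mkcond /=.
  rewrite exchange_big /= big_seq [RHS]big_seq; apply: eq_bigr => u uf.
  rewrite (bigD1_seq (mono_image u)) ?undup_uniq ?mem_undup ?map_f //= eqxx.
  by rewrite big1 ?addr0 // => w /negPf; rewrite eq_sym => ->.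
by rewrite f0 big1 // => w _; rewrite raddf0 scale0r.
Qed.

Variables (wt : 'I_p -> int).
(** For [wt] of value 1 on all the columns this recovers the standard degree. *)
Definition weight (c : 'cV[int]_p) : int := \sum_a wt a * c a ord0.
Hypothesis wt1 : forall j, \sum_a wt a * (e j a)%:Z = 1.

Lemma weight_mono u : weight (mono_multidegree exponent_mx u) = (mdeg u)%:Z.
Proof.
rewrite /weight; under eq_bigr do rewrite mono_multidegreeE mnmE (raddf_sum Posz).
under eq_bigr do rewrite mulr_sumr.
rewrite exchange_big /= mdegE (raddf_sum Posz) /=.
apply: eq_bigr => j _; rewrite -[RHS]mulr1 -(wt1 j) mulr_sumr.
by apply: eq_bigr => a _; rewrite PoszM mulrCA.
Qed.

Lemma mono_image_mdeg u v : mono_image u = mono_image v -> mdeg u = mdeg v.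
Proof.
by move=> /mono_multidegree_eq uv; have := weight_mono u; rewrite uv weight_mono => -[].
Qed.

Lemma toric_map_filter (Q : multinom p -> bool) f :
  toric_map (mfilter (fun u => Q (mono_image u)) f) = mfilter Q (toric_map f).
Proof.
apply/mpolyP => w; rewrite mcoeff_mfilter [X in if _ then X else _]mcoeff_toric_map.
have -> : toric_map (mfilter (fun u => Q (mono_image u)) f) =
    \sum_(u <- msupp f | Q (mono_image u)) toric_map (mcoeff u f *: mpolyX k u).
  exact: raddf_sum.
rewrite raddf_sum.
under eq_bigr do rewrite toric_mapZ toric_mapX /= mcoeffZ mcoeffX.
rewrite big_mkcond; case: ifPn => Qw.
  rewrite [RHS]big_mkcond; apply: eq_bigr => u _.
  case: eqP => [->|_]; last by rewrite mulr0 if_same.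
  by rewrite Qw mulr1.
rewrite big1 // => u _; case: ifP => // Qu; case: eqP => [uw|]; last by rewrite mulr0.
by rewrite -uw Qu in Qw.
Qed.

(** The degree of a monomial is a function of its multidegree, so the kernel of
    [toric_map] contains the homogeneous components of its elements. *)
Lemma toric_ideal_homogeneous : homogeneous_ideal (toric_ideal exponent_mx k).
Proof.
move=> f d /toric_idealP f0; apply/toric_idealP.
pose Q (w : multinom p) := \sum_a wt a * (w a)%:Z == d%:Z.
have -> : pihomog mdeg d f = mfilter (fun u => Q (mono_image u)) f.
  apply/mpolyP => u; rewrite mcoeff_pihomog mcoeff_mfilter.
  rewrite -eqz_nat -weight_mono /weight.
  by under eq_bigr do rewrite mono_multidegreeE.
by rewrite toric_map_filter f0 raddf0.
Qed.

End ToricKernel.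

(** * Polynomials as functions over an infinite field *)

Lemma digits_inj (B n : nat) (u v : nat -> nat) :
  (forall i, i < n -> u i < B)%N -> (forall i, i < n -> v i < B)%N ->
  (\sum_(i < n) u i * B ^ i = \sum_(i < n) v i * B ^ i)%N ->
  forall i, (i < n)%N -> u i = v i.
Proof.
elim: n u v => [//|n IH] u v uB vB.
rewrite !big_ord_recl !expn0 !muln1.
under eq_bigr do rewrite expnS mulnCA.
under [in RHS]eq_bigr do rewrite expnS mulnCA.
rewrite -!big_distrr /= ![(B * _)%N]mulnC => eq_uv.
have u0 := uB 0%N isT; have v0 := vB 0%N isT.
have B0 : (0 < B)%N by apply: leq_ltn_trans u0.
have e0 : u 0%N = v 0%N.
  have := congr1 (modn^~ B) eq_uv.
  by rewrite !(addnC (_ 0%N)) !modnMDl !modn_small.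
move/eqP: eq_uv; rewrite e0 eqn_add2l eqn_pmul2r // => /eqP eq_uv [|i] // lt_i.
by apply: (IH (fun i => u i.+1) (fun i => v i.+1)) => // j ltj; [apply: uB|apply: vB].
Qed.

Section InfiniteField.
Variable k : fieldType.
Hypothesis char0 : [pchar k] =i pred0.

(** In characteristic zero the natural numbers are infinitely many points. *)
Lemma poly_nonroot (g : {poly k}) : g != 0 -> exists t, g.[t] != 0.
Proof.
move=> g0; apply: contrapT => noroot.
have : (size [seq i%:R : k | i <- iota 0 (size g)] < size g)%N.
  apply: max_poly_roots => //; last first.
    rewrite map_inj_uniq ?iota_uniq // => i j /eqP ij.
    wlog le_ij : i j ij / (i <= j)%N => [wl|].
      by case/orP: (leq_total i j) => ?; [|apply: esym]; apply: wl; rewrite // eq_sym.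
    move: ij; rewrite eq_sym -subr_eq0 -natrB // (pcharf0P k).1 // subn_eq0 => le_ji.
    by apply/eqP; rewrite eqn_leq le_ij.
  apply/allP => x _; rewrite rootE; apply: contrapT => /negP gx.
  by apply: noroot; exists x.
by rewrite size_map size_iota ltnn.
Qed.

Lemma meval_mmap (p q : nat) (theta : 'I_q -> {mpoly k[p]}) t f :
  meval t (mmap (@mpolyC p k) theta f) = meval (fun i => meval t (theta i)) f.
Proof.
rewrite [RHS]mevalE.
transitivity (\sum_(u <- msupp f)
    meval t (mpolyC p (mcoeff u f) * mmap1 theta u)); first exact: raddf_sum.
apply: eq_bigr => u _; rewrite mevalM mevalC; congr (_ * _).
by rewrite /mmap1 rmorph_prod; apply: eq_bigr => i _; rewrite rmorphXn.
Qed.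

(** Kronecker's substitution x_i = t^(B^i), with B larger than all the
    exponents, keeps the monomials of f apart. *)
Lemma mpoly_nonroot (p : nat) (f : {mpoly k[p]}) :
  f != 0 -> exists t, meval t f != 0.
Proof.
move=> f0; pose B := msize f.
pose N (u : multinom p) := (\sum_(i < p) u i * B ^ i)%N.
pose g : {poly k} := \sum_(u <- msupp f) mcoeff u f *: 'X^(N u).
have uB u i : u \in msupp f -> (u i < B)%N.
  move=> uf; apply: leq_ltn_trans (msize_mdeg_lt uf).
  by rewrite mdegE (bigD1 i) //= leq_addr.
have Ninj u v : u \in msupp f -> v \in msupp f -> N u = N v -> u = v.
  move=> uf vf Nuv; apply/mnmP => i; rewrite !(mnm_nth 0).
  have ltB w j : w \in msupp f -> (j < p -> nth 0 w j < B)%N.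
    by move=> wf ltj; rewrite -(mnm_nth 0 w (Ordinal ltj)) uB.
  apply: (@digits_inj B p (nth 0%N u) (nth 0%N v)) => // [j|j|]; try exact: ltB.
  by rewrite -[LHS](eq_bigr _ (fun j _ => congr1 (muln^~ _) (mnm_nth 0 u j)))
             -[RHS](eq_bigr _ (fun j _ => congr1 (muln^~ _) (mnm_nth 0 v j))).
have g0 : g != 0.
  have lf := mlead_supp f0.
  apply/eqP => /polyP/(_ (N (mlead f))); rewrite coef0 /g coef_sum.
  rewrite (bigD1_seq _ lf) ?msupp_uniq //= coefZ coefXn eqxx mulr1.
  rewrite big_seq_cond big1 ?addr0 => [/eqP|u /andP[uf /eqP neq]].
    by rewrite mleadc_eq0 (negPf f0).
  by rewrite coefZ coefXn; case: eqP => [/esym/(Ninj _ _ uf lf)//|_]; rewrite mulr0.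
have [t gt] := poly_nonroot g0.
exists (fun i => t ^+ (B ^ i)); apply: contra gt => /eqP <-; apply/eqP.
rewrite mevalE /g horner_sum; apply: eq_bigr => u _.
rewrite hornerZ hornerXn; congr (_ * _).
by rewrite expr_sum; apply: eq_bigr => i _; rewrite -exprM mulnC.
Qed.

End InfiniteField.

(** * Dimension of projective toric varieties *)

Section Irreducible.
Variables (k : fieldType) (q : nat).
Implicit Types (Z : set ('I_q -> k)) (f g : {mpoly k[q]}).

(** The zero sets of f and g form a closed cover of Z. *)
Lemma proj_irreducible_mul Z f g a b :
  proj_irreducible Z -> (forall x, Z x -> exists i, x i != 0) ->
  f \is ishomog1 a mdeg -> g \is ishomog1 b mdeg ->
  (forall x, Z x -> meval x f * meval x g = 0) ->
  (forall x, Z x -> meval x f = 0) \/ (forall x, Z x -> meval x g = 0).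
Proof.
move=> [_ irr] nz fa gb fg.
have closed1 (h : {mpoly k[q]}) c : h \is ishomog1 c mdeg -> proj_closed (proj_zeros [set h]).
  by move=> hc; exists [set h]; split => // _ ->; exists c.
have [|sub|sub] := irr _ _ (closed1 _ _ fa) (closed1 _ _ gb).
- move=> x Zx; have /eqP := fg _ Zx; rewrite mulf_eq0.
  by case/orP => /eqP h0; [left|right]; split; try exact: nz; move=> _ ->.
- by left=> x /sub[_]; apply.
- by right=> x /sub[_]; apply.
Qed.

(** A set parametrised by polynomials is irreducible because its coordinate ring
    embeds in a domain: if neither f1 nor f2 vanishes on Z, then some parameter
    is a zero of neither pullback, nor of a coordinate [theta i0], which makes
    its image a point of the projective space. *)
Lemma param_irreducible (char0 : [pchar k] =i pred0) (p : nat)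
    (theta : 'I_q -> {mpoly k[p]}) Z :
  (forall t, (exists i, meval t (theta i) != 0) -> Z (fun i => meval t (theta i))) ->
  (forall f, mmap (@mpolyC p k) theta f = 0 -> forall x, Z x -> meval x f = 0) ->
  (exists i, theta i != 0) -> proj_irreducible Z.
Proof.
move=> sub dense [i0 nz0]; split.
  have [t nzt] := mpoly_nonroot char0 nz0.
  by exists (fun i => meval t (theta i)); apply: sub; exists i0.
move=> Z1 Z2 [E1 [_ ->]] [E2 [_ ->]] cover.
apply: contrapT => /not_orP[/existsNP[x1 /not_implyP[Zx1 nx1]]
   /existsNP[x2 /not_implyP[Zx2 nx2]]].
have nonzero x : Z x -> exists i, x i != 0.
  by move=> /cover[] [].
have split E x : Z x -> ~ proj_zeros E x -> exists2 f, E f & meval x f != 0.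
  move=> Zx; apply: contra_notP => /forall2NP nE; split; first exact: nonzero.
  by move=> f Ef; case: (nE f) => // /negP; rewrite negbK => /eqP.
have [f1 E1f nf1] := split _ _ Zx1 nx1.
have [f2 E2f nf2] := split _ _ Zx2 nx2.
pose T := mmap (@mpolyC p k) theta.
have T1 : T f1 != 0 by apply: contra nf1 => /eqP /dense ->.
have T2 : T f2 != 0 by apply: contra nf2 => /eqP /dense ->.
have [t] := mpoly_nonroot char0 (mulf_neq0 (mulf_neq0 T1 T2) nz0).
rewrite !mevalM !mulf_eq0 !negb_or /T !meval_mmap => /andP[/andP[n1 n2] n0].
case: (cover _ (sub t _)); first by exists i0.
  by case=> _ /(_ _ E1f)/eqP; rewrite (negPf n1).
by case=> _ /(_ _ E2f)/eqP; rewrite (negPf n2).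
Qed.

End Irreducible.

Section ChainIndependence.
Variables (k : fieldType) (q r : nat) (Z : nat -> set ('I_q -> k)).
Variables (f : nat -> {mpoly k[q]}) (dg : nat -> nat).
Hypothesis f_homog : forall i, (i <= r)%N -> f i \is ishomog1 (dg i) mdeg.
Hypothesis dg0 : dg 0 = 1%N.
Hypothesis Z_irr : forall i, (i <= r)%N -> proj_irreducible (Z i).
Hypothesis Z_nz : forall i, (i <= r)%N -> forall x, Z i x -> exists j, x j != 0.
Hypothesis Z_sub : forall i, (i < r)%N -> Z i `<=` Z i.+1.
Hypothesis f_vanish : forall i x, (i < r)%N -> Z i x -> meval x (f i.+1) = 0.
Hypothesis f_nonvanish : forall i, (i <= r)%N -> exists x, Z i x /\ meval x (f i) != 0.

Definition chain_mono m (al : nat -> nat) : {mpoly k[q]} :=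
  \prod_(i < m.+1) f i ^+ al i.

Lemma chain_mono_homog m al : (m <= r)%N ->
  chain_mono m al \is ishomog1 (\sum_(i < m.+1) al i * dg i)%N mdeg.
Proof.
rewrite /chain_mono; elim: m => [|m IH] mr.
  by rewrite !big_ord1 mulnC; apply/dhomogMn/f_homog.
rewrite big_ord_recr [X in ishomog1 X]big_ord_recr /=; apply: dhomogM; first exact/IH/ltnW.
by rewrite mulnC; apply/dhomogMn/f_homog.
Qed.

(** The forms f_0, ..., f_m are algebraically independent on Z_m, by induction.
    If a combination of monomials in f_0, ..., f_(m+1) vanishes on Z_(m+1),
    cancel the largest power of f_(m+1) that divides it, which irreducibility
    allows; restricting to Z_m, where f_(m+1) vanishes, leaves the terms of
    lowest exponent in f_(m+1). *)
Lemma chain_independent (I : finType) m (al : I -> nat -> nat) (c : I -> k) D :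
  (m <= r)%N ->
  (forall a, c a != 0 -> (\sum_(i < m.+1) al a i * dg i)%N = D) ->
  (forall a b, c a != 0 -> c b != 0 ->
     (forall i, (i <= m)%N -> al a i = al b i) -> a = b) ->
  (forall x, Z m x -> meval x (\sum_a c a *: chain_mono m (al a)) = 0) ->
  forall a, c a = 0.
Proof.
elim: m al c D => [|m IH] al c D mr deg inj van a0; apply: contrapT => /eqP ca0.
  have [x [Zx fx]] := f_nonvanish mr.
  have := van _ Zx; rewrite (bigD1 a0) //= big1 ?addr0 => [|b ba].
    move/eqP; rewrite mevalZ /chain_mono big_ord1 rmorphXn mulf_eq0 (negPf ca0) /=.
    by rewrite expf_eq0 (negPf fx) andbF.
  have [->|cb] := eqVneq (c b) 0; first by rewrite scale0r.
  case/eqP: ba; apply: inj => // i; rewrite leqn0 => /eqP ->.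
  by have := deg _ cb; rewrite -(deg _ ca0) !big_ord1 dg0 !muln1.
have [a1 ca1 min_a1] : exists2 a, c a != 0 &
    forall b, c b != 0 -> (al a m.+1 <= al b m.+1)%N.
  by case: (@arg_minnP I a0 (fun a => c a != 0) (fun a => al a m.+1) ca0) => a ca mina; exists a.
pose e := al a1 m.+1.
pose g := \sum_a c a *: (chain_mono m (al a) * f m.+1 ^+ (al a m.+1 - e)).
have gE : \sum_a c a *: chain_mono m.+1 (al a) = f m.+1 ^+ e * g.
  rewrite mulr_sumr; apply: eq_bigr => a _.
  have [->|ca] := eqVneq (c a) 0; first by rewrite !scale0r mulr0.
  rewrite -scalerAr; congr (_ *: _).
  rewrite /chain_mono big_ord_recr /= mulrCA; congr (_ * _).
  by rewrite -exprD subnKC // min_a1.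
have g_homog : g \is ishomog1 (D - e * dg m.+1)%N mdeg.
  apply: rpred_sum => a _.
  have [->|ca] := eqVneq (c a) 0; first by rewrite scale0r rpred0.
  apply: rpredZ.
  have -> : (D - e * dg m.+1 = \sum_(i < m.+1) al a i * dg i
      + dg m.+1 * (al a m.+1 - e))%N.
    rewrite -(deg _ ca) big_ord_recr /= -addnBA ?leq_mul2r ?min_a1 ?orbT //.
    by rewrite -mulnBl mulnC.
  apply: dhomogM; first exact/chain_mono_homog/ltnW.
  exact/dhomogMn/f_homog.
have [|||||fe0|g0] := @proj_irreducible_mul _ _ (Z m.+1) (f m.+1 ^+ e) g (dg m.+1 * e)
    (D - e * dg m.+1).
- exact: Z_irr.
- exact: Z_nz.
- exact/dhomogMn/f_homog.
- exact: g_homog.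
- by move=> x Zx; rewrite -mevalM -gE van.
- have [x [Zx]] := f_nonvanish mr; have /eqP := fe0 _ Zx.
  by rewrite rmorphXn expf_eq0 => /andP[_ ->].
pose c' a := if al a m.+1 == e then c a else 0.
have c'P a : c' a != 0 -> c a != 0 /\ al a m.+1 = e.
  by rewrite /c'; case: ifP => [/eqP->|_]; rewrite ?eqxx.
have /IH : (m <= r)%N by exact: ltnW.
move=> /(_ al c' (D - e * dg m.+1)%N) c'0.
suff : c' a1 = 0 by apply/eqP; rewrite /c' eqxx.
apply: c'0 => [a /c'P[ca ale]|a b /c'P[ca alea] /c'P[cb aleb] ab|x Zx].
- by rewrite -(deg _ ca) [in RHS]big_ord_recr /= ale addnK.
- apply: inj => // i; rewrite leq_eqVlt => /predU1P[->|]; last exact: ab.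
  by rewrite alea.
transitivity (meval x g); last exact: g0 _ (Z_sub mr Zx).
rewrite (raddf_sum (meval x)) [RHS](raddf_sum (meval x)) /=.
apply: eq_bigr => a _; rewrite /c'; have [ae|ae] := eqVneq (al a m.+1) e.
  by rewrite ae subnn mulr1.
rewrite scale0r meval0 mevalZ mevalM rmorphXn /=.
rewrite f_vanish // expr0n.
have [->|ca] := eqVneq (c a) 0; first by rewrite mul0r.
by rewrite subn_eq0 leqNgt ltn_neqAle eq_sym ae min_a1 //= !mulr0.
Qed.

End ChainIndependence.

Section ToricDimension.
Variables (k : fieldType) (p q : nat) (e : 'I_q -> multinom p.+1).
Variables (wt : 'I_p.+1 -> int) (a0 : 'I_p.+1).
Hypothesis wt1 : forall j, \sum_a wt a * (e j a)%:Z = 1.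
Hypothesis wta0 : wt a0 != 0.

(** A form is determined modulo the toric ideal by its coefficients at the
    multidegrees. The multidegree of a monomial of known degree is determined by
    all its coordinates but one, because the weight gives a linear relation;
    this bounds the number of multidegrees. *)
Lemma forms_dependent (I : finType) (B D : nat) (F : I -> {mpoly k[q]}) :
  (forall j a, e j a <= B)%N ->
  (forall i, F i \is ishomog1 D mdeg) -> ((D * B).+1 ^ p < #|I|)%N ->
  exists c : I -> k, (exists i, c i != 0) /\ toric_map e (\sum_i c i *: F i) = 0.
Proof.
move=> eB Fhom card.
pose K : finType := {ffun 'I_p -> 'I_(D * B).+1}.
(* Dropping the coordinate [a0] keeps multidegrees of the same weight apart. *)
pose e' j : multinom p := Multinom [tuple e j (lift a0 a) | a < p].
pose mon (kap : K) : multinom p := Multinom [tuple (kap a : nat) | a < p].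
pose M : 'M[k]_(#|I|, #|K|) := \matrix_(i, kap)
  mcoeff (mon (enum_val kap)) (toric_map e' (F (enum_val i))).
have : kermx M != 0.
  rewrite kermx_eq0 /row_free neq_ltn; apply/orP; left.
  apply: leq_ltn_trans (rank_leq_col M) _.
  by rewrite card_ffun !card_ord.
case/rowV0Pn => v /sub_kermxP vM v0.
exists (fun i => v ord0 (enum_rank i)).
split.
  case/rV0Pn: v0 => i vi; exists (enum_val i).
  by rewrite enum_valK.
set G := \sum_i _.
have Ghom : G \is ishomog1 D mdeg.
  by apply: rpred_sum => i _; apply: rpredZ; apply: Fhom.
have G'0 kap : mcoeff (mon kap) (toric_map e' G) = 0.
  move/matrixP/(_ ord0 (enum_rank kap)): vM; rewrite !mxE.
  move=> <-.
  have -> : toric_map e' G = \sum_i v ord0 (enum_rank i) *: toric_map e' (F i).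
    rewrite /G (raddf_sum (toric_map e')); apply: eq_bigr => i _.
    exact: toric_mapZ.
  rewrite raddf_sum /= (reindex_onto enum_val enum_rank) => [|i _]; last first.
    by rewrite enum_rankK.
  apply: eq_big => [i|i _]; first by rewrite enum_valK eqxx.
  by rewrite mcoeffZ mxE enum_rankK enum_valK.
apply/mpolyP => w; rewrite raddf0 mcoeff_toric_map.
have [/hasP[u0 u0G /eqP u0w]|/hasPn nou] :=
    boolP (has (fun u => mono_image e u == w) (msupp G)); last first.
  by rewrite big_seq_cond big1 // => u /andP[/nou/negPf->].
have degG u : u \in msupp G -> mdeg u = D.
  by move: u; apply/dhomogP.
have im'E u a : mono_image e' u a = mono_image e u (lift a0 a).
  by rewrite !mnmE; apply: eq_bigr => j _; rewrite mnmE.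
have imB u a : u \in msupp G -> (mono_image e u a < (D * B).+1)%N.
  move=> /degG uD; rewrite ltnS mnmE -uD mdegE big_distrl /=.
  by apply: leq_sum => j _; rewrite leq_mul2l eB orbT.
pose kap : K := [ffun a => inord (mono_image e u0 (lift a0 a))].
have monE : mon kap = mono_image e' u0.
  by apply/mnmP => a; rewrite mnmE ffunE inordK ?imB // im'E.
transitivity (mcoeff (mon kap) (toric_map e' G)); last exact: G'0.
rewrite mcoeff_toric_map monE big_seq_cond [RHS]big_seq_cond.
apply: eq_bigl => u; apply: andb_id2l => uG; rewrite -u0w.
apply/eqP/eqP => [uu0|uu0]; first by apply/mnmP => a; rewrite !im'E uu0.
have coor a : mono_image e u (lift a0 a) = mono_image e u0 (lift a0 a).
  by rewrite -!im'E uu0.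
apply/mnmP => a; have [->|] := eqVneq a a0; last first.
  by rewrite eq_sym => /unlift_some[b -> _]; rewrite coor.
have := weight_mono wt1 u; have := weight_mono wt1 u0.
rewrite !degG // => <-; rewrite /weight.
under eq_bigr do rewrite mono_multidegreeE.
under [RHS]eq_bigr do rewrite mono_multidegreeE.
rewrite (bigD1 a0) // [RHS](bigD1 a0) //=.
have -> : \sum_(i | i != a0) wt i * (mono_image e u i)%:Z =
          \sum_(i | i != a0) wt i * (mono_image e u0 i)%:Z.
  apply: eq_bigr => i; rewrite eq_sym => /unlift_some[b -> _].
  by rewrite coor.
by move=> /addIr /(mulfI wta0) [].
Qed.

(** Take f_i vanishing on Z_(i-1) but not on Z_i, and for f_0 a coordinate. The
    monomials of degree D in these forms are linearly independent on X and
    their number has order of growth D^r, against D^p for the forms on X. *)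
Lemma toric_chain_length r Z :
  irreducible_chain (proj_zeros (toric_ideal (exponent_mx e) k)) r Z -> (r <= p)%N.
Proof.
move=> [Zi Zlt]; rewrite leqNgt; apply/negP => pr.
have Znz i x : (i <= r)%N -> Z i x -> exists j, x j != 0.
  by move=> /Zi[_ _ /(_ x) X] /X[].
have Zirr i : (i <= r)%N -> proj_irreducible (Z i) by move=> /Zi[].
have [x0 Zx0] : Z 0%N !=set0 by have [] := Zirr 0%N isT.
have [j0 xj0] := Znz _ _ (leq0n r) Zx0.
have stepP i : exists fd : {mpoly k[q]} * nat, (i < r)%N ->
   [/\ fd.1 \is ishomog1 fd.2 mdeg, forall x, Z i x -> meval x fd.1 = 0
     & exists x, Z i.+1 x /\ meval x fd.1 != 0].
  have [ir|_] := ltnP i r; last by exists (0, 0%N).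
  have [sub /existsNP[x /not_implyP[Zx nZx]]] := Zlt _ ir.
  have [[E [Eh ZE]] _ _] := Zi _ (ltnW ir).
  have [g Eg gx] : exists2 g, E g & meval x g != 0.
    apply: contrapT => nog; apply: nZx; rewrite ZE; split.
      exact: Znz Zx.
    move=> g Eg; apply: contrapT => /eqP gx; apply: nog; by exists g.
  have [d gd] := Eh _ Eg; exists (g, d) => _; split=> //=; last by exists x.
  by move=> y; rewrite ZE => -[_]; apply.
have [fd fdP] := choice stepP.
pose f i := if i is i'.+1 then (fd i').1 else mpolyX k (mnm1 j0).
pose dg i := if i is i'.+1 then (fd i').2 else 1%N.
pose B := (\sum_j \sum_a e j a)%N.
have eB j a : (e j a <= B)%N.
  rewrite /B (bigD1 j) //= (bigD1 a) //= -addnA; exact: leq_addr.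
pose s := (\sum_(i < r) dg i.+1)%N.
(* The exponents of f_1, ..., f_r are chosen freely below [E] and the exponent
   of f_0 completes the degree to [D = E * s]. With [E] larger than
   [(s * B).+1 ^ p], there are more such monomials than multidegrees. *)
pose E := (((s * B).+1) ^ p).+1.
pose I : finType := {ffun 'I_r -> 'I_E}.
pose D := (E * s)%N.
pose al (g : I) (i : nat) : nat :=
  if i is i'.+1 then (if insub i' is Some i'' then g i'' : nat else 0%N)
  else (D - \sum_(i < r) g i * dg i.+1)%N.
have alS g (i : 'I_r) : al g i.+1 = g i by rewrite /al valK.
have f_homog i : (i <= r)%N -> f i \is ishomog1 (dg i) mdeg.
  by case: i => [_|i /fdP[]//]; rewrite /= dhomogX /= mdeg1.
have al_deg g : (\sum_(i < r.+1) al g i * dg i)%N = D.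
  rewrite big_ord_recl (eq_bigr (fun i : 'I_r => g i * dg i.+1)%N) => [|i _]; last first.
    by rewrite !lift0 alS.
  rewrite [al g _]/= [dg _]/= muln1.
  rewrite subnK // /D /s big_distrr /= leq_sum // => i _.
  by rewrite leq_mul2r (ltnW (ltn_ord _)) orbT.
have Fh g : chain_mono f r (al g) \is ishomog1 D mdeg.
  by have := chain_mono_homog f_homog (al g) (leqnn r); rewrite al_deg.
have cardI : ((D * B).+1 ^ p < #|I|)%N.
  rewrite card_ffun !card_ord.
  apply: (@leq_trans (E ^ p.+1)); last by rewrite leq_pexp2l.
  rewrite expnSr; apply: (@leq_ltn_trans (E ^ p * (s * B).+1 ^ p)).
    have leq_exp2 a b m : (a <= b -> a ^ m <= b ^ m)%N.
      by case: m => // m ab; rewrite leq_exp2r.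
    rewrite -expnMn; apply: leq_exp2.
    by rewrite /D -mulnA mulnS addnC -addn1 leq_add2l.
  by rewrite ltn_pmul2l // expn_gt0.
have [c [[g cg] c0]] := forms_dependent eB Fh cardI.
suff c0' : forall g, c g = 0 by rewrite c0' eqxx in cg.
apply: (@chain_independent k q r Z f dg f_homog erefl Zirr
  (fun i ir x => @Znz i x ir) _ _ _ I r al c D (leqnn r)).
- by move=> i /Zlt[].
- by move=> i x /fdP[_ + _]; apply.
- case=> [_|i /fdP[]//]; exists x0; split=> //.
  by rewrite /= mevalXU.
- by move=> g' _; apply: al_deg.
- move=> g1 g2 _ _ g12; apply/ffunP => i; apply: val_inj => /=.
  by rewrite -!alS g12.
move=> x Zx; have [_ _ /(_ x Zx) [_]] := Zi _ (leqnn r); apply.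
exact/toric_idealP.
Qed.

End ToricDimension.

Section ToricVariety.
Variables (k : fieldType) (p q : nat) (e : 'I_q -> multinom p).
Local Notation X := (proj_zeros (toric_ideal (exponent_mx e) k)).

Lemma toric_point t : (exists i, meval t (mpolyX k (e i)) != 0) ->
  X (fun i => meval t (mpolyX k (e i))).
Proof.
by move=> nz; split=> // f /toric_idealP f0; rewrite -meval_mmap [mmap _ _ _]f0 meval0.
Qed.

Lemma toric_irreducible : [pchar k] =i pred0 -> (0 < q)%N -> proj_irreducible X.
Proof.
move=> char0 q0; apply: (param_irreducible char0 (theta := fun i => mpolyX k (e i))).
- exact: toric_point.
- by move=> f f0 x [_]; apply; apply/toric_idealP.
exists (Ordinal q0); apply/eqP => /mpolyP/(_ (e (Ordinal q0))).
by rewrite mcoeffX eqxx raddf0 => /eqP; rewrite oner_eq0.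
Qed.

(** The homogeneous elements of the toric ideal generate it. *)
Lemma toric_closed (wt : 'I_p -> int) :
  (forall j, \sum_a wt a * (e j a)%:Z = 1) -> proj_closed X.
Proof.
move=> wt1; exists [set f | toric_ideal (exponent_mx e) k f /\
                          exists d, f \is ishomog1 d mdeg].
split; first by move=> f [].
apply/seteqP; split=> x [nz f0]; split=> //.
  by move=> f [If _]; apply: f0.
move=> f If; rewrite (pihomog_partitionE (leqnn (mmeasure mdeg f))).
rewrite raddf_sum big1 // => d _; apply: f0; split.
  exact: toric_ideal_homogeneous wt1 _ _ If.
by exists d; apply: pihomogP.
Qed.

End ToricVariety.

(** * The toric ideal of a pseudomanifold *)

Section Construction.
Variables (n d : nat) (Delta : oriented_pseudomanifold n d).
Local Notation N := #|pm_facets Delta|.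

Definition facet (s : 'I_N) : {set 'I_d} := enum_val s.

(** The exponent of t_a in the degree of the j-th variable. The vertex variable
    x_i has degree e_i and the facet variable z_s has degree e_0 plus the sum of
    the e_b for b outside s, so that z_s times the vertex variables of s has the
    all-ones degree for all s. *)
Definition generator_exponent (j : 'I_(d + N)) (a : 'I_d.+1) : nat :=
  match fintype.split j, unlift ord0 a with
  | inl i, Some b => i == b
  | inl i, None => 0
  | inr s, Some b => b \notin facet s
  | inr s, None => 1
  end.

Definition generator (j : 'I_(d + N)) : multinom d.+1 :=
  Multinom [tuple generator_exponent j a | a < d.+1].

(** The value at e_0 is the one that gives weight 1 to z_s, as there are
    [d - n.+1] vertices outside s. *)
Definition generator_weight (a : 'I_d.+1) : int :=
  if unlift ord0 a is Some _ then 1 else n.+2%:Z - d%:Z.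

Lemma generator_l0 i : generator (lshift N i) ord0 = 0%N.
Proof. by rewrite mnmE /generator_exponent (unsplitK (inl i)) unlift_none. Qed.

Lemma generator_lS i b : generator (lshift N i) (lift ord0 b) = (i == b).
Proof. by rewrite mnmE /generator_exponent (unsplitK (inl i)) liftK. Qed.

Lemma generator_r0 s : generator (rshift d s) ord0 = 1%N.
Proof. by rewrite mnmE /generator_exponent (unsplitK (inr s)) unlift_none. Qed.

Lemma generator_rS s b : generator (rshift d s) (lift ord0 b) = (b \notin facet s).
Proof. by rewrite mnmE /generator_exponent (unsplitK (inr s)) liftK. Qed.

Lemma facetP s : facet s \in pm_facets Delta.
Proof. exact: enum_valP. Qed.

Lemma card_facet s : #|facet s| = n.+1.
Proof. exact/pm_card/facetP. Qed.

Lemma pm_dim_lt : (n < d)%N.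
Proof.
have /finset.set0Pn[s sD] := pm_nonempty Delta.
by have := max_card (mem s); rewrite (pm_card sD) card_ord.
Qed.

Lemma pm_facet_exists : (0 < N)%N.
Proof. by rewrite card_gt0 pm_nonempty. Qed.

Lemma generator_weight1 j :
  \sum_a generator_weight a * (generator j a)%:Z = 1.
Proof.
rewrite big_ord_recl [generator_weight ord0]/generator_weight unlift_none.
under eq_bigr do rewrite /generator_weight liftK mul1r.
rewrite -[j]splitK; case: (fintype.split j) => [i|s] /=.
  rewrite generator_l0 mulr0 add0r (bigD1 i) //= generator_lS eqxx big1 ?addr0 //.
  by move=> b /negPf; rewrite generator_lS eq_sym => ->.
rewrite generator_r0 mulr1 -(raddf_sum Posz) /=.
under eq_bigr do rewrite generator_rS.
have -> : (\sum_(i < d) (i \notin facet s) = d - n.+1)%N.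
  transitivity #|finset.setC (facet s)|.
    rewrite -sum1_card [RHS]big_mkcond; apply: eq_bigr => i _.
    by rewrite finset.in_setC; case: (_ \in _).
  by have := cardsC (facet s); rewrite card_facet card_ord; lia.
have := pm_dim_lt; lia.
Qed.

Lemma generator_col_inj : injective (fun j => col j (exponent_mx generator)).
Proof.
move=> j1 j2 /matrixP c12.
have g12 a : generator j1 a = generator j2 a.
  by have := c12 a ord0; rewrite !mxE => -[].
move: g12; rewrite -[j1]splitK -[j2]splitK.
case: (fintype.split j1) (fintype.split j2) => [i1|s1] [i2|s2] /= g12.
- have := g12 (lift ord0 i1); rewrite !generator_lS eqxx.
  by case: eqP => [->|].
- by have := g12 ord0; rewrite generator_l0 generator_r0.
- by have := g12 ord0; rewrite generator_l0 generator_r0.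
congr (rshift _ _); apply: enum_val_inj; apply/setP => b.
have := g12 (lift ord0 b); rewrite !generator_rS /facet.
by case: (b \in enum_val s1); case: (b \in enum_val s2).
Qed.

Variable (k : fieldType).
Local Notation X := (proj_zeros (toric_ideal (exponent_mx generator) k)).

Definition coordinate_subspace (i : nat) : set ('I_(d + N) -> k) :=
  [set x | (exists j, x j != 0) /\ forall j : 'I_(d + N), (i < j)%N -> x j = 0].

Lemma coordinate_subspace_closed i : proj_closed (coordinate_subspace i).
Proof.
exists [set f | exists2 j : 'I_(d + N), (i < j)%N & f = mpolyX k (mnm1 j)].
split; first by move=> _ [j _ ->]; exists 1%N; rewrite dhomogX /= mdeg1.
apply/seteqP; split=> x [nz x0]; split=> //.
  by move=> _ [j ij ->]; rewrite mevalXU x0.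
by move=> j ij; rewrite -(mevalXU x j) x0 //; exists j.
Qed.

Lemma coordinate_subspace_irreducible i : [pchar k] =i pred0 ->
  proj_irreducible (coordinate_subspace i).
Proof.
move=> char0.
pose th (j : 'I_(d + N)) := if (j <= i)%N then mpolyX k (mnm1 j) else 0.
have q0 : (0 < d + N)%N by rewrite addn_gt0 pm_facet_exists orbT.
apply: (param_irreducible char0 (theta := th)).
- move=> t nz; split=> // j ij.
  by rewrite /th leqNgt ij meval0.
- move=> f f0 x [_ x0].
  rewrite (@meval_eq _ _ _ (fun j => meval x (th j))) => [|j]; last first.
    rewrite /th; case: leqP => [_|/x0 ->]; first by rewrite mevalXU.
    by rewrite meval0.
  by rewrite -meval_mmap f0 meval0.
exists (Ordinal q0); rewrite /th /=.
apply/eqP => /mpolyP/(_ (mnm1 (Ordinal q0))).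
by rewrite mcoeffX eqxx raddf0 => /eqP; rewrite oner_eq0.
Qed.

(** The points with all z_s = 0 come from the parameters with t_0 = 0. *)
Lemma coordinate_subspace_sub i : (i < d)%N -> coordinate_subspace i `<=` X.
Proof.
move=> id x [nz x0].
pose t a := if unlift ord0 a is Some b then x (lshift N b) else 0.
have tx j : meval t (mpolyX k (generator j)) = x j.
  rewrite mevalX big_ord_recl {1}/t unlift_none.
  under eq_bigr do rewrite /t liftK.
  rewrite -[j]splitK; case: (fintype.split j) => [b|s] /=.
    rewrite generator_l0 expr0 mul1r (bigD1 b) //= generator_lS eqxx expr1.
    rewrite big1 ?mulr1 // => c /negPf; rewrite generator_lS eq_sym => ->.
    by rewrite expr0.
  rewrite generator_r0 expr1 mul0r x0 //=; apply: leq_trans id _; exact: leq_addr.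
have -> : x = (fun j => meval t (mpolyX k (generator j))).
  by apply/funext => j; rewrite tx.
by apply: toric_point; case: nz => j xj; exists j; rewrite tx.
Qed.

(** The chain consists of the coordinate subspaces of the projective space
    where all z_s = 0, then X, which contains the point (1, ..., 1). *)
Lemma toric_dimension : [pchar k] =i pred0 -> proj_dimension X d.
Proof.
move=> char0; have d0 : (0 < d)%N by apply: leq_ltn_trans pm_dim_lt.
have q0 : (0 < d + N)%N by rewrite addn_gt0 d0.
split; last first.
  move=> r Z; apply: (toric_chain_length generator_weight1 (a0 := lift ord0 (Ordinal d0))).
  by rewrite /generator_weight liftK.
exists (fun i => if (i < d)%N then coordinate_subspace i else X); split=> i le_id.
  case: ifP => id; split.
  - exact: coordinate_subspace_closed.
  - exact: coordinate_subspace_irreducible.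
  - exact: coordinate_subspace_sub.
  - exact: toric_closed generator_weight1.
  - exact: toric_irreducible.
  - by [].
rewrite le_id; have [id|di] := ltnP i.+1 d.
  split=> [x [nz x0]|].
    by split=> // j ij; apply: x0; apply: ltnW.
  have iq : (i.+1 < d + N)%N by apply: leq_trans id (leq_addr _ _).
  move=> /(_ (fun j => (j == Ordinal iq)%:R)) [].
    split; first by exists (Ordinal iq); rewrite eqxx oner_neq0.
    by move=> j ij; case: eqP => // je; move: ij; rewrite je ltnn.
  by move=> _ /(_ (Ordinal iq) (leqnn _))/eqP; rewrite eqxx oner_eq0.
split; first exact: coordinate_subspace_sub.
have one j : meval (fun=> 1) (mpolyX k (generator j)) = 1.
  by rewrite mevalX big1 // => a _; rewrite expr1n.
move=> /(_ (fun j => meval (fun=> 1) (mpolyX k (generator j)))) [].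
  by apply: toric_point; exists (Ordinal q0); rewrite one oner_neq0.
move=> _ /(_ (rshift d (Ordinal pm_facet_exists))) /=.
rewrite one addn0 => /(_ le_id)/eqP.
by rewrite oner_eq0.
Qed.

End Construction.

(** * Noetherianity *)

(** Induction on the number m of coordinates compared. Vectors with a large new
    coordinate dominate an element found for the old coordinates; the finitely
    many small values of the new coordinate are treated one by one. *)
Lemma dickson_prefix (q m : nat) (P : set (multinom q)) :
  exists s : seq (multinom q), (forall u, u \in s -> P u) /\
    forall u, P u -> exists2 v, v \in s & forall j : 'I_q, (j < m)%N -> (v j <= u j)%N.
Proof.
elim: m P => [|m IH] P.
  have [[u Pu]|noP] := pselect (exists u, P u); last first.
    by exists [::]; split=> // u Pu; case: noP; exists u.
  by exists [:: u]; split=> [v|v _]; [rewrite inE => /eqP -> | exists u; rewrite ?inE].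
have [qm|mq] := leqP q m.
  have [s [sP domP]] := IH P; exists s; split=> // u /domP[v vs vu].
  by exists v => // j _; apply: vu; apply: leq_trans (ltn_ord j) qm.
pose j0 := Ordinal mq.
have [s [sP domP]] := IH P.
pose c := (\sum_(v <- s) v j0)%N.
have [t tP] := choice (fun i => IH [set u | P u /\ u j0 = i]).
exists (s ++ flatten [seq t i | i <- iota 0 c]); split=> [u|u Pu].
  rewrite mem_cat => /orP[/sP//|/flattenP[_ /mapP[i _ ->]]].
  by have [/(_ u) tiP _] := tP i => /tiP[].
have [cu|uc] := leqP c (u j0).
  have [v vs vu] := domP _ Pu; exists v; first by rewrite mem_cat vs.
  move=> j; rewrite ltnS leq_eqVlt => /predU1P[jm|]; last exact: vu.
  have -> : j = j0 by apply: val_inj.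
  apply: leq_trans cu; rewrite /c (big_rem v) //=; exact: leq_addr.
have [tiP /(_ u (conj Pu erefl))[v vt vu]] := tP (u j0).
exists v.
  rewrite mem_cat; apply/orP; right; apply/flattenP; exists (t (u j0)) => //.
  by apply: map_f; rewrite mem_iota.
move=> j; rewrite ltnS leq_eqVlt => /predU1P[jm|]; last exact: vu.
have -> : j = j0 by apply: val_inj.
by have [_ ->] := tiP _ vt.
Qed.

Lemma dickson (q : nat) (P : set (multinom q)) :
  exists s : seq (multinom q), (forall u, u \in s -> P u) /\
    forall u, P u -> exists2 v, v \in s & lem v u.
Proof.
have [s [sP dom]] := dickson_prefix q P; exists s; split=> // u /dom[v vs vu].
by exists v => //; apply/mnm_lepP => j; apply: vu.
Qed.

Section Noetherian.
Variables (k : fieldType) (q : nat).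
Local Notation S := {mpoly k[q]}.

Definition is_ideal (I : set S) :=
  I 0 /\ forall a f g, I f -> I g -> I (a * f + g).

(** The list is a Groebner basis: by Dickson's lemma finitely many leading
    monomials divide all the others, and division lowers the leading monomial.
    That the list generates I is said impredicatively: every ideal containing
    the list contains I. *)
Lemma ideal_fg (I : set S) : is_ideal I ->
  exists s : seq S, (forall g, g \in s -> I g) /\
    forall J, is_ideal J -> (forall g, g \in s -> J g) -> I `<=` J.
Proof.
move=> [I0 IM].
have [us [usP dom]] := dickson [set u | exists f : S, [/\ I f, f != 0 & mlead f = u]].
have liftP u : exists f : S, u \in us -> [/\ I f, f != 0 & mlead f = u].
  have [/usP[f ?]|_] := boolP (u \in us); first by exists f.
  by exists 0.
have [F FP] := choice liftP.
exists [seq F u | u <- us]; split=> [_ /mapP[u /FP[? _ _] ->]//|J [J0 JM] sJ f].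
elim/mleadrect: f => f IH If.
have [->//|f0] := eqVneq f 0.
have [v vus vf] : exists2 v, v \in us & lem v (mlead f) by apply: dom; exists f.
have [Ig g0 gv] := FP _ vus.
have Jg : J (F v) by apply/sJ/map_f.
set g := F v in Ig g0 gv Jg.
pose a : S := (mcoeff (mlead f) f / mcoeff v g) *: mpolyX k (mnm_sub (mlead f) v).
have gv0 : mcoeff v g != 0 by rewrite -gv mleadc_eq0.
have agE w : mcoeff (mnm_add w (mnm_sub (mlead f) v)) (a * g) =
    mcoeff (mlead f) f / mcoeff v g * mcoeff w g.
  by rewrite /a -scalerAl mcoeffZ [mpolyX _ _ * g]mulrC addmC mcoeffMX.
have vfE : mnm_add v (mnm_sub (mlead f) v) = mlead f by rewrite addmC submK.
have a0 : a != 0.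
  by rewrite scaler_eq0 mulf_eq0 invr_eq0 mleadc_eq0 (negPf f0) (negPf gv0) /= -msupp_eq0 msuppX.
have agl : mlead (a * g) = mlead f.
  rewrite mleadM // gv /a mleadZ ?mleadXm; last first.
    by rewrite mulf_eq0 invr_eq0 mleadc_eq0 (negPf f0).
  by rewrite addmC.
pose h := f - a * g.
have fE : f = a * g + h by rewrite addrC subrK.
have [h0|h0] := eqVneq h 0.
  by rewrite fE h0; apply: JM.
have hlt : (mlead h < mlead f)%O.
  have le_h : (mlead h <= mlead f)%O.
    by have := mleadB_le f (a * g); rewrite agl joinxx.
  rewrite lt_neqAle le_h andbT; apply/eqP => hf.
  have := agE v; rewrite vfE divfK // => agv.
  by move: h0; rewrite -mleadc_eq0 hf /h mcoeffB agv subrr eqxx.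
rewrite fE; apply: JM => //; apply: IH hlt _.
have -> : h = (- a) * g + f by rewrite mulNr addrC.
exact: IM.
Qed.

Definition submodule r (M : set 'rV[S]_r) :=
  M 0 /\ forall a u v, M u -> M v -> M (a *: u + v).

(** Induction on the number m of coordinates that may be nonzero: the last of
    them take values in an ideal, and the elements where it is zero form a
    submodule with fewer coordinates. *)
Lemma submodule_fg r (M : set 'rV[S]_r) : submodule M ->
  exists s : seq 'rV[S]_r, (forall g, g \in s -> M g) /\
    forall M', submodule M' -> (forall g, g \in s -> M' g) -> M `<=` M'.
Proof.
have [m suppM] : exists m, forall v, M v -> forall j : 'I_r, (m <= j)%N -> v ord0 j = 0.
  by exists r => v _ j; rewrite leqNgt ltn_ord.
elim: m M suppM => [|m IH] M suppM [M0 MM].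
  exists [::]; split=> // M' [M'0 _] _ v /suppM v0.
  suff -> : v = 0 by [].
  by apply/rowP => j; rewrite v0 // mxE.
have [rm|mr] := leqP r m.
  apply: IH => // v Mv j mj; apply: suppM => //.
  by have := leq_trans (leq_ltn_trans mj (ltn_ord j)) rm; rewrite ltnn.
pose j0 := Ordinal mr.
have [|sI [sII genI]] := @ideal_fg [set f | exists2 v, M v & v ord0 j0 = f].
  split=> [|a _ _ [u Mu <-] [v Mv <-]]; first by exists 0; rewrite ?mxE.
  by exists (a *: u + v); [apply: MM | rewrite !mxE].
have [||s0 [s0M gen0]] := IH [set v | M v /\ v ord0 j0 = 0].
- move=> v [Mv v0] j; rewrite leq_eqVlt => /predU1P[mj|]; last exact: suppM.
  by have -> : j = j0 by apply: val_inj.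
- split=> [|a u v [Mu u0] [Mv v0]]; first by rewrite /= mxE.
  by split; [apply: MM | rewrite !mxE u0 v0 mulr0 addr0].
have liftP g : exists v, g \in sI -> M v /\ v ord0 j0 = g.
  have [/sII[v ? ?]|_] := boolP (g \in sI); first by exists v.
  by exists 0.
have [V VP] := choice liftP.
exists ([seq V g | g <- sI] ++ s0); split=> [g|M' subM' sM' v Mv].
  by rewrite mem_cat => /orP[/mapP[f /VP[? _] ->]//|/s0M[]].
have [M'0 M'M] := subM'.
have [|||w [Mw M'w] wv] := genI [set f | exists2 w, M w /\ M' w & w ord0 j0 = f] _ _ (v ord0 j0).
- split=> [|a _ _ [u [Mu M'u] <-] [w [Mw M'w] <-]]; first by exists 0; rewrite ?mxE.
  by exists (a *: u + w); [split; [apply: MM|apply: M'M] | rewrite !mxE].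
- move=> g gs; exists (V g); last by have [] := VP _ gs.
  by split; [have [] := VP _ gs | apply: sM'; rewrite mem_cat map_f].
- by exists v.
have -> : v = 1 *: w + (-1 *: w + v) by rewrite scale1r scaleN1r addrA subrr add0r.
apply: M'M => //; apply: gen0 => //; first by move=> g gs; apply: sM'; rewrite mem_cat gs orbT.
split; first exact: MM.
by rewrite !mxE wv mulN1r addNr.
Qed.

End Noetherian.

(** * Multigraded free modules *)

Section Graded.
Variables (k : fieldType) (p q : nat) (A : 'M[int]_(p, q)) (wt : 'I_p -> int).
Hypothesis wA : forall u, weight wt (mono_multidegree A u) = (mdeg u)%:Z.
Local Notation S := {mpoly k[q]}.
Local Notation degree := ('cV[int]_p).
Local Notation mdg := (mono_multidegree A).

Lemma mono_multidegreeD u v : mdg (mnm_add u v) = mdg u + mdg v.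
Proof.
rewrite -mulmxDr; congr (_ *m _); apply/matrixP => i j.
by rewrite !mxE mnmDE PoszD.
Qed.

Lemma mono_multidegree0 : mdg (@mnm0 q) = 0.
Proof.
by apply: (addrI (mdg (@mnm0 q))); rewrite -mono_multidegreeD addm0 addr0.
Qed.

Lemma weightD (x y : degree) : weight wt (x + y) = weight wt x + weight wt y.
Proof. by rewrite -big_split; apply: eq_bigr => a _; rewrite mxE mulrDr. Qed.

(** The component of degree [tau] in the free module whose b-th basis vector has
    degree [mu b]. *)
Definition hcomp r (mu : 'I_r -> degree) (tau : degree) (v : 'rV[S]_r) : 'rV[S]_r :=
  \row_b mfilter (fun u => mdg u + mu b == tau) (v ord0 b).

Definition homogeneous r (mu : 'I_r -> degree) (tau : degree) (v : 'rV[S]_r) :=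
  forall b u, u \in msupp (v ord0 b) -> mdg u + mu b = tau.

Definition graded_mx r s (mu : 'I_r -> degree) (nu : 'I_s -> degree)
    (D : 'M[S]_(r, s)) := forall a, homogeneous nu (mu a) (row a D).

Lemma hcompD r (mu : 'I_r -> degree) tau u v :
  hcomp mu tau (u + v) = hcomp mu tau u + hcomp mu tau v.
Proof. by apply/rowP => b; rewrite !mxE raddfD. Qed.

Lemma hcomp0 r (mu : 'I_r -> degree) tau : hcomp mu tau 0 = 0.
Proof. by apply/rowP => b; rewrite !mxE raddf0. Qed.

Lemma hcomp_homogeneous r (mu : 'I_r -> degree) tau v :
  homogeneous mu tau (hcomp mu tau v).
Proof.
move=> b u; rewrite mcoeff_msupp mxE mcoeff_mfilter.
by case: ifP => [/eqP//|_]; rewrite eqxx.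
Qed.

Lemma hcomp_id r (mu : 'I_r -> degree) tau v :
  homogeneous mu tau v -> hcomp mu tau v = v.
Proof.
move=> vh; apply/rowP => b; rewrite mxE; apply/mpolyP => u.
rewrite mcoeff_mfilter; case: eqP => // nu.
by rewrite memN_msupp_eq0 //; apply/negP => /vh.
Qed.

Lemma mfilter_mul (P Q : multinom q -> bool) (f g : S) :
  (forall u v, v \in msupp g -> P (mnm_add u v) = Q u) ->
  mfilter P (f * g) = mfilter Q f * g.
Proof.
move=> PQ; apply/mpolyP => w; rewrite mcoeff_mfilter !mcoeffM.
rewrite -[LHS]/(if P w then _ else 0).
transitivity (\sum_(kk : bmultinom q (mdeg w).+1 * bmultinom q (mdeg w).+1 | w == mnm_add kk.1 kk.2)
   (if P w then mcoeff kk.1 f * mcoeff kk.2 g else 0)).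
  by case: ifP => // _; rewrite big1.
apply: eq_bigr => kk /eqP wE; rewrite mcoeff_mfilter.
have [kg|kg] := boolP (bmnm kk.2 \in msupp g); last first.
  by rewrite (memN_msupp_eq0 kg) !mulr0 if_same.
by rewrite (etrans (congr1 P wE) (PQ _ _ kg)); case: ifP => // _; rewrite mul0r.
Qed.

Lemma hcomp_mul r s (mu : 'I_r -> degree) (nu : 'I_s -> degree) D tau v :
  graded_mx mu nu D -> hcomp nu tau (v *m D) = hcomp mu tau v *m D.
Proof.
move=> gD; apply/rowP => b; rewrite !mxE raddf_sum; apply: eq_bigr => a _ /=.
rewrite mxE; apply: mfilter_mul => u w wD.
by rewrite mono_multidegreeD -addrA -(gD a b w) // mxE.
Qed.

Lemma hcomp_sum r (mu : 'I_r -> degree) v :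
  exists s : seq degree, v = \sum_(tau <- s) hcomp mu tau v.
Proof.
pose s := undup (flatten [seq [seq mdg u + mu b | u <- msupp (v ord0 b)] | b <- enum 'I_r]).
exists s; apply/rowP => b; rewrite summxE; apply/mpolyP => u; rewrite raddf_sum /=.
under eq_bigr do rewrite mxE mcoeff_mfilter.
have [uv|uv] := boolP (u \in msupp (v ord0 b)); last first.
  by rewrite memN_msupp_eq0 // big1 // => t _; rewrite if_same.
rewrite (bigD1_seq (mdg u + mu b)) ?undup_uniq //=.
  by rewrite eqxx big1 ?addr0 // => t /negPf; rewrite eq_sym => ->.
rewrite mem_undup; apply/flattenP.
exists [seq mdg u + mu b | u <- msupp (v ord0 b)]; last exact: map_f.
by apply: map_f; rewrite mem_enum.
Qed.

Lemma mono_multidegree_eq0 u : mdg u = 0 -> u = @mnm0 q.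
Proof.
move=> u0; apply/eqP; rewrite -mdeg_eq0 -eqz_nat -wA u0.
by rewrite /weight big1 // => a _; rewrite mxE mulr0.
Qed.

(** For a graded D, this says that the rows of D minimally generate their span,
    by the graded Nakayama lemma. *)
Definition minimal_relations r s (D : 'M[S]_(r, s)) :=
  forall v : 'rV_r, v *m D = 0 -> forall b, mcoeff (@mnm0 q) (v ord0 b) = 0.

Definition generates r s (D : 'M[S]_(r, s)) (M : set 'rV[S]_s) :=
  forall v, M v <-> exists w : 'rV_r, v = w *m D.

(** The component of the relation in the degree of the row a has a unit as a-th
    entry, hence expresses this row through the others. *)
Lemma unit_relation r s (mu : 'I_r.+1 -> degree) (nu : 'I_s -> degree)
    (D : 'M[S]_(r.+1, s)) (v : 'rV[S]_r.+1) a M :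
  graded_mx mu nu D -> generates D M -> v *m D = 0 ->
  mcoeff (@mnm0 q) (v ord0 a) != 0 -> generates (row' a D) M.
Proof.
move=> gD genD vD va x.
have mulE (w : 'rV[S]_r.+1) : w ord0 a = 0 -> w *m D = col' a w *m row' a D.
  move=> w0; apply/rowP => b; rewrite !mxE (bigD1_ord a) //= w0 mul0r add0r.
  by apply: eq_bigr => i _; rewrite !mxE.
rewrite genD; split=> [[w ->]|[w ->]]; last first.
  pose w' : 'rV[S]_r.+1 := \row_j oapp (fun i : 'I_r => (w : 'rV[S]_r) ord0 i) 0 (unlift a j).
  exists w'; rewrite mulE; last by rewrite mxE unlift_none.
  by congr (_ *m _); apply/rowP => j; rewrite !mxE liftK.
pose v' := hcomp mu (mu a) v.
have v'D : v' *m D = 0 by rewrite -(hcomp_mul _ _ gD) vD hcomp0.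
pose c := mcoeff (@mnm0 q) (v ord0 a).
have v'a : v' ord0 a = mpolyC q c.
  apply/mpolyP => u; rewrite mxE mcoeff_mfilter mcoeffC.
  rewrite -[X in _ == X]add0r (inj_eq (addIr _)).
  have [->|u0] := eqVneq u (@mnm0 q).
    by rewrite mono_multidegree0 eqxx mulr1.
  by rewrite mulr0; case: ifP => // /eqP/mono_multidegree_eq0 /eqP; rewrite (negPf u0).
pose w' := w - (mpolyC q c^-1 * w ord0 a) *: v'.
exists (col' a w'); rewrite -mulE.
  by rewrite mulmxBl -scalemxAl v'D scaler0 subr0.
have -> : w' ord0 a = w ord0 a - mpolyC q c^-1 * w ord0 a * v' ord0 a.
  by rewrite /w' 3!mxE.
by rewrite v'a mulrAC -mpolyCM mulVf // mpolyC1 mul1r subrr.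
Qed.

Definition homogeneous_submodule r (mu : 'I_r -> degree) (M : set 'rV[S]_r) :=
  submodule M /\ forall tau v, M v -> M (hcomp mu tau v).

Lemma submodule_sum r (M : set 'rV[S]_r) (I : Type) (s : seq I) (P : pred I) F :
  submodule M -> (forall i, P i -> M (F i)) -> M (\sum_(i <- s | P i) F i).
Proof.
move=> [M0 MM] MF; elim/big_rec: _ => // i x /MF Mi Mx.
by rewrite -[F i]scale1r; apply: MM.
Qed.

Lemma mulmx_submodule r s (D : 'M[S]_(r, s)) :
  submodule [set v : 'rV_s | exists w : 'rV_r, v = w *m D].
Proof.
split=> [|a _ _ [u ->] [v ->]]; first by exists 0; rewrite mul0mx.
by exists (a *: u + v); rewrite mulmxDl scalemxAl.
Qed.

Lemma homogeneous_generators r (mu : 'I_r -> degree) (M : set 'rV[S]_r) :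
  homogeneous_submodule mu M ->
  exists m (D : 'M[S]_(m, r)) (nu : 'I_m -> degree),
    graded_mx nu mu D /\ generates D M.
Proof.
move=> [subM hM]; have [s [sM gen]] := submodule_fg subM.
have [T TP] := choice (hcomp_sum mu).
pose L := flatten [seq [seq (tau, v) | tau <- T v] | v <- s].
pose x i := tnth (in_tuple L) i.
pose nu i := (x i).1.
pose D : 'M[S]_(size L, r) := \matrix_i hcomp mu (x i).1 (x i).2.
have LM i : M (row i D).
  rewrite rowK; apply: hM; apply: sM.
  have : x i \in L by apply: mem_tnth.
  by case/flattenP => _ /mapP[v vs ->] /mapP[tau _ ->].
exists (size L), D, nu; split=> [a|v].
  by rewrite rowK; apply: hcomp_homogeneous.
split=> [Mv|[w ->]]; last first.
  rewrite mulmx_sum_row; apply: submodule_sum => // i _.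
  by rewrite -[_ *: _]addr0; have [M0 MM] := subM; apply: MM.
apply: (gen [set v | exists w : 'rV_(size L), v = w *m D]) => //.
  exact: mulmx_submodule.
move=> g gs; rewrite (TP g) big_seq.
apply: (submodule_sum _ (mulmx_submodule D)) => tau tauT.
have inL : (tau, g) \in L.
  by apply/flattenP; exists [seq (tau, g) | tau <- T g]; apply: map_f.
have lt_i : (index (tau, g) L < size L)%N by rewrite index_mem.
exists (delta_mx ord0 (Ordinal lt_i)); rewrite -rowE rowK /x.
by rewrite (tnth_nth (tau, g)) /= nth_index.
Qed.

(** Take a homogeneous generating system with as few elements as possible. *)
Lemma minimal_generators r (mu : 'I_r -> degree) (M : set 'rV[S]_r) :
  homogeneous_submodule mu M ->
  exists m (D : 'M[S]_(m, r)) (nu : 'I_m -> degree),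
    [/\ graded_mx nu mu D, generates D M & minimal_relations D].
Proof.
move=> hM.
pose P m := `[< exists (D : 'M[S]_(m, r)) (nu : 'I_m -> degree),
    graded_mx nu mu D /\ generates D M >].
have exP : exists m, P m.
  have [m [D [nu ?]]] := homogeneous_generators hM.
  by exists m; apply/asboolP; exists D, nu.
case: (ex_minnP exP) => m /asboolP[D [nu [gD genD]]] minm.
exists m, D, nu; split=> // v vD b; apply: contrapT => /eqP vb.
case: m D nu gD genD minm v vD b vb => [|m] D nu gD genD minm v vD b vb.
  by case: b vb.
suff /minm : P m by rewrite ltnn.
apply/asboolP; exists (row' b D), (nu \o lift b); split.
  by move=> a c u; have := gD (lift b a) c u; rewrite !mxE.
exact: unit_relation gD genD vD vb.
Qed.

Lemma kernel_homogeneous r s (mu : 'I_r -> degree) (nu : 'I_s -> degree) D :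
  graded_mx mu nu D -> homogeneous_submodule mu [set v | v *m D = 0].
Proof.
move=> gD; split=> [|tau v vD]; last by rewrite /= -(hcomp_mul _ _ gD) vD hcomp0.
split=> [|a u v uD vD]; first by rewrite /= mul0mx.
by rewrite /= mulmxDl -scalemxAl uD vD scaler0 addr0.
Qed.

Lemma minimal_row_neq0 r s (D : 'M[S]_(r, s)) a :
  minimal_relations D -> row a D != 0.
Proof.
move=> minD; apply/eqP => aD.
have /minD/(_ a) : (delta_mx ord0 a : 'rV[S]_r) *m D = 0 by rewrite -rowE.
by rewrite mxE !eqxx mcoeff1 eqxx => /eqP; rewrite oner_eq0.
Qed.

Lemma graded_row_support r s (mu : 'I_r -> degree) (nu : 'I_s -> degree) D a :
  graded_mx mu nu D -> row a D != 0 ->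
  exists b u, u \in msupp (D a b) /\ mu a = mdg u + nu b.
Proof.
move=> gD /rV0Pn[b]; rewrite mxE => ab.
exists b, (mlead (D a b)); split; first exact: mlead_supp.
by rewrite (gD a b) // mxE mlead_supp.
Qed.

End Graded.

(** * Existence of minimal free resolutions *)

Section Resolution.
Variables (k : fieldType) (p q : nat) (e : 'I_q -> multinom p) (wt : 'I_p -> int).
Hypothesis wt1 : forall j, \sum_a wt a * (e j a)%:Z = 1.
Local Notation A := (exponent_mx e).
Local Notation S := {mpoly k[q]}.
Local Notation degree := ('cV[int]_p).
Local Notation mdg := (mono_multidegree A).
Let wA := weight_mono wt1.

Lemma mcoeff0_toric_ideal f : toric_ideal A k f -> mcoeff (@mnm0 q) f = 0.
Proof.
move=> /toric_idealP f0.
have /mpolyP/(_ (mono_image e (@mnm0 q))) := f0; rewrite raddf0 mcoeff_toric_map.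
have [uf <-|/memN_msupp_eq0 -> //] := boolP (@mnm0 q \in msupp f).
rewrite (big_rem (@mnm0 q)) //= eqxx big_seq_cond big1 ?addr0 // => u.
rewrite mem_rem_uniq ?msupp_uniq // => /andP[/[!inE]/andP[u0 _] /eqP uE].
have /(mono_multidegree_eq0 wA)/eqP : mdg u = 0.
  by rewrite -(mono_multidegree0 A); apply/mono_multidegree_eq.
by rewrite (negPf u0).
Qed.

Definition toric_submodule : set 'rV[S]_1 := [set v | toric_ideal A k (v ord0 ord0)].

Lemma toric_submodule_homogeneous :
  homogeneous_submodule A (fun _ : 'I_1 => 0) toric_submodule.
Proof.
split=> [|tau v /toric_idealP v0].
  split=> [|a u v /toric_idealP u0 /toric_idealP v0]; apply/toric_idealP.
    by rewrite mxE raddf0.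
  rewrite !mxE.
  have -> : toric_map e (a * u ord0 ord0 + v ord0 ord0) =
      toric_map e a * toric_map e (u ord0 ord0) + toric_map e (v ord0 ord0).
    by rewrite -(rmorphM (toric_map e)); apply: (raddfD (toric_map e)).
  by rewrite u0 v0 mulr0 addr0.
apply/toric_idealP; rewrite mxE.
pose Q (w : multinom p) := \col_a (w a)%:Z + 0 == tau.
have -> : (fun u => mdg u + 0 == tau) = (fun u => Q (mono_image e u)).
  apply/funext => u; rewrite /Q; congr (_ + 0 == _).
  by apply/matrixP => a b; rewrite ord1 mono_multidegreeE mxE.
by rewrite toric_map_filter v0 raddf0.
Qed.

(** A differential of the resolution with what the construction of the next one
    needs. The weights are nonnegative, hence usable as standard degrees. *)
Record stage := Stage {
  st_src : nat;
  st_tgt : nat;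
  st_src_deg : 'I_st_src -> degree;
  st_tgt_deg : 'I_st_tgt -> degree;
  st_diff : 'M[S]_(st_src, st_tgt);
  st_graded : graded_mx A st_src_deg st_tgt_deg st_diff;
  st_minimal : minimal_relations st_diff;
  st_tgt_pos : forall b, 0 <= weight wt (st_tgt_deg b)
}.

Arguments st_graded : clear implicits.
Arguments st_minimal : clear implicits.
Arguments st_tgt_pos : clear implicits.

Lemma st_src_pos s a : 0 <= weight wt (st_src_deg (s := s) a).
Proof.
have [b [u [_ ->]]] := graded_row_support (st_graded s)
  (minimal_row_neq0 a (st_minimal s)).
by rewrite weightD wA addr_ge0 // st_tgt_pos.
Qed.

Lemma next_stage_exists s : exists t : {m : nat & (('I_m -> degree) * 'M[S]_(m, st_src s))%type},
  [/\ graded_mx A (projT2 t).1 (st_src_deg (s := s)) (projT2 t).2,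
      minimal_relations (projT2 t).2
    & generates (projT2 t).2 [set v | v *m st_diff s = 0]].
Proof.
have [m [D [nu [gD genD minD]]]] :=
  minimal_generators wA (kernel_homogeneous (st_graded s)).
by exists (existT _ m (nu, D)).
Qed.

Definition next_stage (s : stage) : stage :=
  let t := cid (next_stage_exists s) in
  Stage (let: And3 g _ _ := projT2 t in g) (let: And3 _ m _ := projT2 t in m)
    (@st_src_pos s).

Lemma next_stageP s :
  generates (st_diff (next_stage s) : 'M[S]_(_, st_src s)) [set v | v *m st_diff s = 0].
Proof. by rewrite /next_stage; case: cid => t []. Qed.

Lemma first_stage_exists : exists t : {m : nat & (('I_m -> degree) * 'M[S]_(m, 1))%type},
  [/\ graded_mx A (projT2 t).1 (fun=> 0) (projT2 t).2,
      minimal_relations (projT2 t).2 & generates (projT2 t).2 toric_submodule].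
Proof.
have [m [D [nu [gD genD minD]]]] := minimal_generators wA toric_submodule_homogeneous.
by exists (existT _ m (nu, D)).
Qed.

Lemma weight0_ge0 (b : 'I_1) : 0 <= weight wt 0.
Proof. by rewrite /weight big1 // => a _; rewrite mxE mulr0. Qed.

Definition first_stage : stage :=
  let t := cid first_stage_exists in
  @Stage _ 1 _ (fun=> 0) _ (let: And3 g _ _ := projT2 t in g)
    (let: And3 _ m _ := projT2 t in m) weight0_ge0.

Lemma first_stageP : generates (st_diff first_stage : 'M[S]_(_, 1)) toric_submodule.
Proof. by rewrite /first_stage; case: cid => t []. Qed.

Definition resolution_stage i : stage := iter i next_stage first_stage.

Definition resolution : free_sequence k p q :=
  @FreeSequence k p q (fun i => st_tgt (resolution_stage i))
    (fun i b => `|weight wt (st_tgt_deg (s := resolution_stage i) b)|%N)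
    (fun i b => st_tgt_deg (s := resolution_stage i) b)
    (fun i => st_diff (resolution_stage i)).

Lemma resolution_minimal : minimal_resolution A resolution.
Proof.
split=> [//|b|i a b u ub|f|i v|i a b].
- by rewrite /= /weight big1 // => j _; rewrite mxE mulr0.
- have := st_graded (resolution_stage i) a b u; rewrite mxE => /(_ ub) aE.
  split; last exact: esym aE.
  have := st_tgt_pos (resolution_stage i) b; have := st_src_pos a.
  have := congr1 (weight wt) aE; rewrite weightD wA /=.
  by rewrite /=; lia.
- have := first_stageP (const_mx f); rewrite /toric_submodule /= mxE => ->.
  by split=> -[w wE]; exists w.
- exact: next_stageP.
case: i a b => [|i] a b.
  have rowI : toric_submodule (row a (st_diff first_stage)).
    by apply/first_stageP; exists (delta_mx ord0 a); apply: rowE.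
  by have := mcoeff0_toric_ideal rowI; rewrite mxE [b]ord1.
have : row a (st_diff (resolution_stage i.+1)) *m st_diff (resolution_stage i) = 0.
  by apply/(@next_stageP (resolution_stage i)); exists (delta_mx ord0 a); apply: rowE.
by move=> /(st_minimal (resolution_stage i))/(_ b); rewrite mxE.
Qed.

End Resolution.

(** * Koszul differentials *)

Lemma antisymmetric_sum (V : zmodType) d (F : 'I_d -> 'I_d -> V) :
  (forall i, F i i = 0) -> (forall i j, F i j = - F j i) -> \sum_i \sum_j F i j = 0.
Proof.
move=> F0 FN; rewrite pair_big /=.
rewrite (bigID (fun ij : 'I_d * 'I_d => (ij.1 < ij.2)%N)) /=.
rewrite [X in _ + X](bigID (fun ij : 'I_d * 'I_d => (ij.2 < ij.1)%N)) /=.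
rewrite [X in _ + (_ + X)]big1 ?addr0; last first.
  move=> [i j] /= /andP[]; rewrite -!leqNgt => ji ij.
  by have -> : i = j by apply/val_inj/eqP; rewrite eqn_leq ij ji.
rewrite [X in _ + X](reindex_inj (h := fun ij : 'I_d * 'I_d => (ij.2, ij.1))) /=; last first.
  by move=> [i j] [i' j'] [-> ->].
rewrite [X in _ + X](eq_big (fun ij : 'I_d * 'I_d => (ij.1 < ij.2)%N)
  (fun ij => - F ij.1 ij.2)) => [|[i j]|[i j] _] /=.
- by rewrite sumrN subrr.
- by rewrite -leqNgt; case: ltngtP.
- exact: FN.
Qed.

Section Koszul.
Variables (R : comNzRingType) (d : nat) (x : 'I_d -> R).

Definition koszul_sign (j : 'I_d) (T : {set 'I_d}) : int :=
  (-1) ^+ #|[set u in T | (u < j)%N]%SET|.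

(** An element of the exterior algebra with coefficients in a free module is
    given by its coefficients [c T] on the basis vectors e_T. This is the
    contraction with the linear form of values x_j. *)
Definition koszul r (c : {set 'I_d} -> 'rV[R]_r) (T : {set 'I_d}) : 'rV[R]_r :=
  \sum_(j | j \notin T) (x j *: c (j |: T)%SET) *~ koszul_sign j T.

Lemma koszul_sign_setU1 j l (T : {set 'I_d}) : l \notin T ->
  koszul_sign j (l |: T)%SET = (-1) ^+ (l < j)%N * koszul_sign j T.
Proof.
move=> lT; rewrite /koszul_sign -exprD; congr (_ ^+ _).
have [lj|jl] := ltnP l j; last first.
  apply: eq_card => u; rewrite !inE.
  by have [->|_] := eqVneq u l; rewrite //= ltnNge jl /= andbF.
have -> : [set u in (l |: T)%SET | (u < j)%N]%SET = (l |: [set u in T | (u < j)%N])%SET.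
  by apply/setP => u; rewrite !inE; have [->|_] := eqVneq u l; rewrite //= lj.
by rewrite cardsU1 !inE (negPf lT).
Qed.

Lemma koszul_koszul r (c : {set 'I_d} -> 'rV[R]_r) T : koszul (koszul c) T = 0.
Proof.
pose F j l : 'rV[R]_r := if (j \notin T) && (l \notin (j |: T)%SET) then
  ((x j * x l) *: c (l |: (j |: T))%SET) *~ (koszul_sign l (j |: T)%SET * koszul_sign j T)
  else 0.
transitivity (\sum_j \sum_l F j l).
  rewrite /koszul big_mkcond; apply: eq_bigr => j _; rewrite /F.
  case: ifP => jT; last by rewrite big1 // => l _.
  rewrite scaler_sumr mulrz_suml big_mkcond; apply: eq_bigr => l _ /=.
  case: ifP => // lT; rewrite mulrzA; congr (_ *~ _).
  by rewrite -scalerMzr scalerA.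
apply: antisymmetric_sum => [j|j l]; rewrite /F.
  by rewrite !inE eqxx andbF.
rewrite !inE !negb_or eq_sym.
have [->|jl] /= := eqVneq l j; first by rewrite !andbF oppr0.
have [jT|jT] /= := boolP (j \in T); first by rewrite !andbF oppr0.
have [lT|lT] /= := boolP (l \in T); first by rewrite oppr0.
rewrite -mulrNz mulrC finset.setUCA; congr (_ *~ _).
rewrite !koszul_sign_setU1 //.
have : (j < l)%N = ~~ (l < j)%N by move: jl; rewrite -val_eqE /=; case: ltngtP.
move=> ->; case: (l < j)%N => /=; rewrite ?expr0 ?expr1; lia.
Qed.

End Koszul.

Section HomogeneousCombinations.
Variables (k : fieldType) (p q : nat) (A : 'M[int]_(p, q)) (r : nat)
  (mu : 'I_r -> 'cV[int]_p).
Local Notation S := {mpoly k[q]}.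

Lemma hcomp_homogeneousE tau (v : 'rV[S]_r) :
  homogeneous A mu tau v <-> hcomp A mu tau v = v.
Proof. by split=> [/hcomp_id //|<-]; apply: hcomp_homogeneous. Qed.

Lemma homogeneous_sum (I : finType) (P : pred I) tau (F : I -> 'rV[S]_r) :
  (forall i, P i -> homogeneous A mu tau (F i)) ->
  homogeneous A mu tau (\sum_(i | P i) F i).
Proof.
move=> hF; apply/hcomp_homogeneousE.
rewrite (big_morph _ (hcompD A mu tau) (hcomp0 k A mu tau)).
by apply: eq_bigr => i /hF/hcomp_homogeneousE.
Qed.

Lemma homogeneousN tau (v : 'rV[S]_r) :
  homogeneous A mu tau v -> homogeneous A mu tau (- v).
Proof.
by move=> hv b u; rewrite mxE (perm_mem (msuppN _)); apply: hv.
Qed.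

Lemma homogeneous_signz tau (v : 'rV[S]_r) m :
  homogeneous A mu tau v -> homogeneous A mu tau (v *~ (-1) ^+ m).
Proof.
rewrite -signr_odd; case: (odd m); rewrite ?expr0 ?expr1 ?mulrN1z ?mulr1z //.
exact: homogeneousN.
Qed.

Lemma homogeneous_scaleX tau u (v : 'rV[S]_r) :
  homogeneous A mu tau v ->
  homogeneous A mu (mono_multidegree A u + tau) (mpolyX k u *: v).
Proof.
move=> hv; apply/hcomp_homogeneousE; rewrite -[in RHS](hcomp_id hv).
apply/rowP => b; rewrite !mxE mulrC [RHS]mulrC.
apply: mfilter_mul => w w'; rewrite msuppX inE => /eqP ->.
by rewrite mono_multidegreeD addrAC addrC (inj_eq (addrI _)).
Qed.

End HomogeneousCombinations.

(** * The linear syzygy of a pseudomanifold *)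

Section FundamentalCycle.
Variables (n d : nat) (Delta : oriented_pseudomanifold n d) (k : fieldType).
Local Notation N := #|pm_facets Delta|.
Local Notation e := (generator (Delta := Delta)).
Local Notation A := (exponent_mx e).
Local Notation q := (d + N)%N.
Local Notation S := {mpoly k[q]}.
Local Notation mdg := (mono_multidegree A).
Local Notation wt := (generator_weight n (d := d)).

Definition vertex_var j : S := mpolyX k (mnm1 (lshift N j)).
Definition facet_var s : S := mpolyX k (mnm1 (rshift d s)).

Let wA := weight_mono (@generator_weight1 n d Delta).

(** The multidegree left after removing the vertex variables of [T] from the
    all-ones degree. *)
Definition residual (T : {set 'I_d}) : 'cV[int]_d.+1 :=
  \col_a (if unlift ord0 a is Some j then (j \notin T : nat)%:Z else 1).

Lemma mono_image_mnm1 j : mono_image e (mnm1 j) = e j.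
Proof.
apply/mnmP => a; rewrite mnmE (bigD1 j) //= mnm1E eqxx mul1n big1 ?addn0 //.
by move=> i /negPf; rewrite mnm1E eq_sym => ->.
Qed.

Lemma residual_setU1 j (T : {set 'I_d}) : j \notin T ->
  mdg (mnm1 (lshift N j)) + residual (j |: T)%SET = residual T.
Proof.
move=> jT; apply/matrixP => a b; rewrite !ord1 mxE mono_multidegreeE mono_image_mnm1 !mxE.
case: unliftP => [i|] ->; last by rewrite generator_l0.
rewrite generator_lS !inE; have [<-|ji] := eqVneq j i.
  by rewrite jT.
by rewrite /= add0r.
Qed.

Lemma residual_facet s : mdg (mnm1 (rshift d s)) = residual (facet s).
Proof.
apply/matrixP => a b; rewrite !ord1 mono_multidegreeE mono_image_mnm1 !mxE.
case: unliftP => [i|] ->; last by rewrite generator_r0.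
by rewrite generator_rS.
Qed.

Lemma weight_residual T : weight wt (residual T) = n.+2%:Z - #|T|%:Z.
Proof.
have dE : (#|T| + #|finset.setC T|)%N = d by rewrite cardsC card_ord.
have Td : (#|T| <= d)%N by have := leq_addr #|finset.setC T| #|T|; rewrite dE.
rewrite /weight big_ord_recl !mxE unlift_none {1}/generator_weight unlift_none mulr1.
under eq_bigr do rewrite mxE liftK /generator_weight liftK mul1r.
rewrite -(raddf_sum Posz) /=.
have -> : (\sum_(i < d) (i \notin T) = d - #|T|)%N.
  transitivity #|finset.setC T|.
    rewrite -sum1_card [RHS]big_mkcond; apply: eq_bigr => i _.
    by rewrite finset.in_setC; case: (_ \in _).
  by apply/eqP; rewrite -(eqn_add2l #|T|) dE subnKC.
by move: (#|T|) Td => t; lia.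
Qed.

(** The fundamental cycle: the signed sum over the facets s of z_s e_s. *)
Definition fundamental_cycle (T : {set 'I_d}) : S :=
  \sum_(s : 'I_N | facet s == T) facet_var s *~ (-1) ^+ pm_orient Delta T.

Lemma sum_facet_eq (V : zmodType) T (x : V) :
  \sum_(s : 'I_N | facet s == T) x = if T \in pm_facets Delta then x else 0.
Proof.
case: ifPn => TD.
  rewrite (bigD1 (enum_rank_in TD T)) /= ?big1 ?addr0 //.
    move=> s /andP[/eqP sT]; rewrite -(inj_eq enum_val_inj) enum_rankK_in //.
    by rewrite -/(facet s) sT eqxx.
  by rewrite /facet enum_rankK_in.
rewrite big_pred0 // => s; apply/negP => /eqP sT.
by move: TD; rewrite -sT facetP.
Qed.

(** The ridge T lies in no facet, or in two whose orientations cancel on T. *)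
Lemma facet_signs_cancel (T : {set 'I_d}) : #|T| = n ->
  \sum_(j | (j \notin T) && ((j |: T)%SET \in pm_facets Delta))
    induced_sign (pm_orient Delta) (j |: T)%SET j = 0.
Proof.
move=> Tn.
pose J := [set j | (j \notin T) && ((j |: T)%SET \in pm_facets Delta)]%SET.
have cardJ : #|J| = #|[set s in pm_facets Delta | T \subset s]%SET|.
  rewrite -(card_in_imset (f := fun j => (j |: T)%SET) (D := mem J)); last first.
    move=> i j; rewrite !inE => /andP[iT _] /andP[jT _] /setP/(_ i).
    by rewrite !inE eqxx (negPf iT) !orbF => /esym/eqP.
  apply: eq_card => s; rewrite !inE; apply/imsetP/andP.
    by case=> j; rewrite !inE => /andP[_ jD] ->; split=> //; apply: finset.subsetUr.
  case=> sD Ts; have : #|(s :\: T)%SET| = 1%N.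
    rewrite cardsD (finset.setIidPr Ts) (pm_card sD) Tn; lia.
  move/eqP/cards1P => [j /setP jE].
  have := jE j; rewrite !inE eqxx => /andP[jT js].
  have sE : s = (j |: T)%SET.
    apply/setP => i; have := jE i; rewrite !inE.
    have [iT _|iT /= ->] := boolP (i \in T); last by rewrite orbF.
    by rewrite orbT; apply: (fintype.subsetP Ts).
  by exists j; rewrite ?inE ?jT -?sE.
transitivity (\sum_(j in J) induced_sign (pm_orient Delta) (j |: T)%SET j).
  by apply: eq_bigl => j; rewrite inE.
case: (pm_ridge Delta Tn); rewrite -cardJ.
  by move/eqP; rewrite cards_eq0 => /eqP ->; rewrite finset.big_set0.
move/eqP/cards2P => [v [w [vw JE]]].
have : v \in J by rewrite JE !inE eqxx.
rewrite inE => /andP[vT vD].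
have : w \in J by rewrite JE !inE eqxx orbT.
rewrite inE => /andP[wT wD].
rewrite JE finset.big_setU1 ?inE //= finset.big_set1.
exact: pm_cancel.
Qed.

Lemma induced_signE j (T : {set 'I_d}) :
  induced_sign (pm_orient Delta) (j |: T)%SET j =
  (-1) ^+ pm_orient Delta (j |: T)%SET * koszul_sign j T.
Proof.
rewrite /induced_sign /koszul_sign; congr (_ * _ ^+ _).
apply: eq_card => u; rewrite !inE.
by have [->|_] := eqVneq u j; rewrite //= ltnn !andbF.
Qed.

(** The coefficient of e_T in the Koszul boundary of the fundamental cycle. *)
Definition cycle_boundary (T : {set 'I_d}) : S :=
  \sum_(j | j \notin T) (vertex_var j * fundamental_cycle (j |: T)%SET) *~ koszul_sign j T.

(** All the monomials x_j z_s in this sum have the multidegree [residual T], so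
    membership in the toric ideal only depends on the sum of the signs. *)
Lemma cycle_boundary_toric (T : {set 'I_d}) : #|T| = n -> toric_ideal A k (cycle_boundary T).
Proof.
move=> Tn; apply/toric_idealP.
pose w : multinom d.+1 := Multinom [tuple `|residual T a ord0|%N | a < d.+1].
have prodE j s : j \notin T -> facet s = (j |: T)%SET ->
    toric_map e (vertex_var j * facet_var s) = mpolyX k w.
  move=> jT sT; rewrite /vertex_var /facet_var -mpolyXD toric_mapX; congr mpolyX.
  have wE : mdg (mnm_add (mnm1 (lshift N j)) (mnm1 (rshift d s))) = residual T.
    by rewrite mono_multidegreeD residual_facet sT residual_setU1.
  by apply/mnmP => a; rewrite [RHS]mnmE -wE mono_multidegreeE absz_nat.
transitivity (mpolyX k w *~ \sum_(j | (j \notin T) && ((j |: T)%SET \in pm_facets Delta))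
    induced_sign (pm_orient Delta) (j |: T)%SET j); last first.
  by rewrite facet_signs_cancel // mulr0z.
rewrite (raddf_sum (toric_map e)) mulrz_sumr [RHS]big_mkcondr; apply: eq_bigr => j jT.
rewrite (raddfMz (toric_map e)) mulr_sumr (raddf_sum (toric_map e)) mulrz_suml.
transitivity (\sum_(s : 'I_N | facet s == (j |: T)%SET)
    mpolyX k w *~ induced_sign (pm_orient Delta) (j |: T)%SET j).
  apply: eq_bigr => s /eqP sT; rewrite mulrzAr (raddfMz (toric_map e)) /= prodE //.
  by rewrite induced_signE mulrzA.
exact: sum_facet_eq.
Qed.

End FundamentalCycle.

Section Zigzag.
Variables (n d : nat) (Delta : oriented_pseudomanifold n d) (k : fieldType).
Local Notation N := #|pm_facets Delta|.
Local Notation e := (generator (Delta := Delta)).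
Local Notation A := (exponent_mx e).
Local Notation q := (d + N)%N.
Local Notation S := {mpoly k[q]}.
Local Notation mdg := (mono_multidegree A).
Local Notation wt := (generator_weight n (d := d)).
Local Notation x := (vertex_var Delta k).
Local Notation z := (@facet_var n d Delta k).
Variable G : free_sequence k d.+1 q.
Hypothesis resG : minimal_resolution A G.
Local Notation mu i := (@fr_multideg k d.+1 q G i).
Local Notation D i := (fr_diff G i).

Let wA := weight_mono (@generator_weight1 n d Delta).

Lemma res_graded i : graded_mx A (mu i.+1) (mu i) (D i).
Proof. by move=> a b u; rewrite mxE => /(mr_graded resG)[_ ->]. Qed.

Lemma res_minimal i : minimal_relations (D i).
Proof.
move=> v /(mr_exact resG)[w ->] b; rewrite mxE raddf_sum big1 // => a _ /=.
by rewrite mcoeffM big1 // => kk /eqP/esym/eqP; rewrite mnmD_eq0 => /andP[_ /eqP ->];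
  rewrite (mr_minimal resG) mulr0.
Qed.

Lemma res_support i (a : 'I_(fr_rank G i.+1)) :
  exists b u, u \in msupp (D i a b).
Proof.
have [b [u [ub _]]] := graded_row_support (@res_graded i)
  (minimal_row_neq0 a (@res_minimal i)).
by exists b, u.
Qed.

Lemma fr_degE i (a : 'I_(fr_rank G i)) : (fr_deg a)%:Z = weight wt (mu i a).
Proof.
elim: i a => [|i IH] a.
  have [-> ->] := mr_deg0 resG a.
  by rewrite /weight big1 // => j _; rewrite mxE mulr0.
have [b [u uab]] := res_support a; have [-> ->] := mr_graded resG uab.
by rewrite PoszD weightD wA IH.
Qed.

(** The toric ideal contains no linear form, since the variables have distinct
    multidegrees; each further step raises degrees by at least one. *)
Lemma fr_deg_ge i (a : 'I_(fr_rank G i.+1)) : (i.+2 <= fr_deg a)%N.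
Proof.
elim: i a => [|i IH] a.
  have [b [u uab]] := res_support a; have [-> _] := mr_graded resG uab.
  apply: leq_trans (leq_addr _ _); rewrite ltnNge; apply/negP => u1.
  have fI : toric_ideal A k (D 0 a b).
    apply/(mr_coker resG); exists (delta_mx ord0 a); apply/rowP => b'.
    rewrite -rowE !mxE; congr (D 0 a _); move: b b' {uab}; rewrite (mr_rank0 resG).
    by move=> b b'; rewrite !ord1.
  have u_unique v : v \in msupp (D 0 a b) -> mono_image e v = mono_image e u -> v = u.
    move=> _ vu; have mvu : mdeg v = mdeg u.
      by apply: (mono_image_mdeg (@generator_weight1 n d Delta)).
    case: (posnP (mdeg u)) => [u0|u_gt].
      by have /eqP := mvu; rewrite u0 mdeg_eq0 => /eqP ->; apply/esym/eqP; rewrite -mdeg_eq0 u0.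
    have /eqP/mdeg1P[j /eqP uj] : mdeg u = 1%N by apply/eqP; rewrite eqn_leq u1.
    have /eqP/mdeg1P[j' /eqP vj] : mdeg v = 1%N by rewrite mvu uj mdeg1.
    rewrite uj vj; congr mnm1; apply: (@generator_col_inj n d Delta).
    apply/matrixP => i c; rewrite !mxE; congr Posz.
    by move: vu; rewrite uj vj !mono_image_mnm1 => ->.
  have /toric_idealP/mpolyP/(_ (mono_image e u)) := fI.
  rewrite raddf0 mcoeff_toric_map (big_rem u uab) /= eqxx big_seq_cond big1 ?addr0.
    by move/eqP; rewrite mcoeff_eq0 uab.
  move=> v /andP[]; rewrite mem_rem_uniq ?msupp_uniq // inE => /andP[/eqP vu vD] /eqP.
  by move=> /(u_unique _ vD).
have [b [u uab]] := res_support a; have [-> _] := mr_graded resG uab.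
rewrite -[i.+3]add1n leq_add // lt0n mdeg_eq0; apply: contraTneq uab => ->.
by rewrite mcoeff_msupp (mr_minimal resG) eqxx.
Qed.

(** No generator of G_(i+1) has a degree below that of [residual T], so the
    monomials occurring in v are constant. *)
Lemma homogeneous_strand i (T : {set 'I_d}) (v : 'rV[S]_(fr_rank G i.+1)) :
  (#|T| + i.+1 = n.+1)%N -> homogeneous A (mu i.+1) (residual T) v ->
  v = map_mx (@mpolyC q k) (map_mx (mcoeff (@mnm0 q)) v) /\
  forall b, mcoeff (@mnm0 q) (v ord0 b) != 0 -> fr_deg b = i.+2.
Proof.
move=> Ti hv.
have degv b u : u \in msupp (v ord0 b) -> u = @mnm0 q /\ fr_deg b = i.+2.
  move=> /hv /(congr1 (weight wt)); rewrite weightD wA -fr_degE weight_residual => uE.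
  have := fr_deg_ge b => degb.
  have : mdeg u = 0%N /\ fr_deg b = i.+2 by lia.
  by case=> /eqP; rewrite mdeg_eq0 => /eqP.
split=> [|b]; last by rewrite -mcoeff_msupp => /degv[].
apply/rowP => b; rewrite !mxE; apply/mpolyP => u; rewrite mcoeffC.
have [->|u0] := eqVneq u (@mnm0 q); first by rewrite mulr1.
rewrite mulr0 memN_msupp_eq0 //; apply: contraNN u0 => /degv[->].
by [].
Qed.

(** Lifts of the fundamental cycle along the resolution: [zigzag i.+1] lifts
    the Koszul boundary of [zigzag i] through the differential of [G]. *)
Fixpoint zigzag i : {set 'I_d} -> 'rV[S]_(fr_rank G i) :=
  if i is i'.+1 then fun T =>
    xget 0 [set w | homogeneous A (mu i'.+1) (residual T) w /\
                    w *m D i' = koszul x (zigzag i') T]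
  else fun T => const_mx (fundamental_cycle Delta k T).

Arguments zigzag i T : simpl never.

Lemma koszul_homogeneous i (c : {set 'I_d} -> 'rV[S]_(fr_rank G i)) (T : {set 'I_d}) :
  (forall j, j \notin T -> homogeneous A (mu i) (residual (j |: T)%SET) (c (j |: T)%SET)) ->
  homogeneous A (mu i) (residual T) (koszul x c T).
Proof.
move=> hc; apply: homogeneous_sum => j jT; apply: homogeneous_signz.
rewrite -(@residual_setU1 n d Delta j) //; apply: homogeneous_scaleX.
exact: hc.
Qed.

Lemma koszul_mul r s (c : {set 'I_d} -> 'rV[S]_r) (E : 'M[S]_(r, s)) T :
  koszul x c T *m E = koszul x (fun U => c U *m E) T.
Proof.
rewrite mulmx_suml; apply: eq_bigr => j _.
rewrite scalemxAl; exact: (raddfMz (mulmxr E)).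
Qed.

Lemma eq_koszul r (c c' : {set 'I_d} -> 'rV[S]_r) (T : {set 'I_d}) :
  (forall j, j \notin T -> c (j |: T)%SET = c' (j |: T)%SET) ->
  koszul x c T = koszul x c' T.
Proof. by move=> cc'; apply: eq_bigr => j /cc' ->. Qed.

Lemma koszul_cycle T :
  koszul x (zigzag 0) T = const_mx (cycle_boundary Delta k T).
Proof.
apply/rowP => b; rewrite summxE mxE; apply: eq_bigr => j _.
transitivity ((x j *: zigzag 0 (j |: T)%SET) ord0 b *~ koszul_sign j T).
  rewrite /koszul_sign -signr_odd; case: (odd _); rewrite ?expr0 ?expr1 ?mulr1z //.
  by rewrite !mulrN1z mxE.
by rewrite !mxE.
Qed.

(** The Koszul boundary of [zigzag i] is killed by the differential of G since
    the Koszul boundary squares to zero; exactness lifts it, and the lift can be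
    replaced by its component of the right multidegree. *)
Lemma zigzagP i (T : {set 'I_d}) : (#|T| + i = n.+1)%N ->
  homogeneous A (mu i) (residual T) (zigzag i T) /\
  match i return 'rV[S]_(fr_rank G i) -> Prop with
  | 0 => fun=> True
  | i'.+1 => fun w => w *m D i' = koszul x (zigzag i') T
  end (zigzag i T).
Proof.
elim: i T => [|i IH] T Ti.
  split=> // b u; rewrite mxE; have [_ ->] := mr_deg0 resG b; rewrite addr0.
  move=> /msupp_sum_le/flattenP[_ /mapP[s + ->]].
  rewrite mem_filter => /andP[/eqP sT _] us.
  suff -> : u = mnm1 (rshift d s) by rewrite residual_facet sT.
  move: us; rewrite -signr_odd; case: (odd _); rewrite ?expr0 ?expr1 ?mulrN1z ?mulr1z.
    by rewrite (perm_mem (msuppN _)) msuppX inE => /eqP.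
  by rewrite msuppX inE => /eqP.
set v := koszul x (zigzag i) T.
have cardU j : j \notin T -> (#|(j |: T)%SET| + i = n.+1)%N.
  by move=> jT; rewrite cardsU1 jT -Ti; lia.
have hv : homogeneous A (mu i) (residual T) v.
  by apply: koszul_homogeneous => j /cardU/IH[].
have [w wE] : exists w, v = w *m D i.
  case: i @v IH Ti cardU hv => [|i] v IH Ti cardU hv.
    rewrite /v koszul_cycle; have Tn : #|T| = n by lia.
    by have /(mr_coker resG)[w <-] := @cycle_boundary_toric n d Delta k T Tn; exists w.
  apply/(mr_exact resG); rewrite /v koszul_mul -(koszul_koszul x (zigzag i) T).
  by apply: eq_koszul => j /cardU/IH[_].
have := @xgetPex _ 0 [set w | homogeneous A (mu i.+1) (residual T) w /\
                    w *m D i = koszul x (zigzag i) T].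
move=> -[|? ?]; last by split.
exists (hcomp A (mu i.+1) (residual T) w); split; first exact: hcomp_homogeneous.
by rewrite -(hcomp_mul _ _ (@res_graded i)) -wE hcomp_id.
Qed.

Hypothesis n_gt0 : (0 < n)%N.

(** The constant vector of F_i underlying [zigzag i T]. *)
Definition zigzag_coef i T : 'rV[k]_(fr_rank G i) := map_mx (mcoeff (@mnm0 q)) (zigzag i T).

Lemma zigzag_coefE i (T : {set 'I_d}) : (#|T| + i.+1 = n.+1)%N ->
  zigzag i.+1 T = map_mx (@mpolyC q k) (zigzag_coef i.+1 T).
Proof.
by move=> Ti; have [h _] := zigzagP Ti; exact: (homogeneous_strand Ti h).1.
Qed.

Lemma zigzag_coef_deg i (T : {set 'I_d}) b : (#|T| + i.+1 = n.+1)%N ->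
  zigzag_coef i.+1 T ord0 b != 0 -> fr_deg b = i.+2 /\ mu i.+1 b = residual T.
Proof.
move=> Ti; have [h _] := zigzagP Ti; have [_ hs] := homogeneous_strand Ti h.
rewrite mxE => b0; split; first exact: hs.
have := h b (@mnm0 q); rewrite mcoeff_msupp mono_multidegree0 add0r; exact.
Qed.

Lemma mcoeff_koszul_sum i (T : {set 'I_d}) u : (#|T| + i.+2 = n.+1)%N ->
  map_mx (mcoeff u) (koszul x (zigzag i.+1) T) =
  \sum_(j | j \notin T)
    ((mnm1 (lshift N j) == u)%:R *: zigzag_coef i.+1 (j |: T)%SET) *~ koszul_sign j T.
Proof.
move=> Ti; rewrite raddf_sum; apply: eq_bigr => j jT.
rewrite raddfMz /=; congr (_ *~ _); apply/rowP => b.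
rewrite zigzag_coefE; last by rewrite cardsU1 jT -Ti; lia.
by rewrite !mxE mulrC mul_mpolyC mcoeffZ mcoeffX mulrC.
Qed.

Lemma mcoeff_koszul i (T : {set 'I_d}) j : (#|T| + i.+2 = n.+1)%N -> j \notin T ->
  map_mx (mcoeff (mnm1 (lshift N j))) (koszul x (zigzag i.+1) T) =
  zigzag_coef i.+1 (j |: T)%SET *~ koszul_sign j T.
Proof.
move=> Ti jT; rewrite mcoeff_koszul_sum // (bigD1 j) //= eqxx scale1r.
rewrite big1 ?addr0 // => l /andP[lT /negPf lj].
by rewrite eq_mnm1 (inj_eq (@lshift_inj _ _)) lj scale0r mul0rz.
Qed.

Lemma sign_mulz_eq0 (V : zmodType) (v : V) m : v *~ (-1) ^+ m = 0 -> v = 0.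
Proof.
rewrite -signr_odd; case: (odd m); rewrite ?expr0 ?expr1 ?mulrN1z ?mulr1z //.
by move=> /eqP; rewrite oppr_eq0 => /eqP.
Qed.

(** Descending induction on i. If the lift at step i + 2 vanishes on the faces
    containing v, so does the Koszul boundary of the lift at step i + 1; its
    coefficients at the variables are, up to sign, the constant vectors of this
    lift on larger faces. *)
Lemma zigzag_vanish i (T : {set 'I_d}) v : zigzag n [set v]%SET = 0 ->
  (#|T| + i.+1 = n.+1)%N -> v \in T -> zigzag i.+1 T = 0.
Proof.
move=> v0 Ti0; have [t tn] : exists t, (t + i.+1 = n.+1)%N.
  by exists (n - i)%N; lia.
move: Ti0; elim: t => [|t IH] in i tn T *.
  move=> Ti vT; have : (0 < #|T|)%N by apply/card_gt0P; exists v.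
  by lia.
move=> Ti vT.
have [t0|t_gt0] := posnP t.
  have iE : i.+1 = n by lia.
  have : #|T| == 1%N by lia.
  case/cards1P => w TE; move: vT; rewrite TE inE => /eqP <-.
  by rewrite iE.
have [j jT jv] : exists2 j, j \in T & j != v.
  have : (0 < #|(T :\ v)%SET|)%N by have := cardsD1 v T; rewrite vT; lia.
  by case/card_gt0P => j; rewrite !inE => /andP[? ?]; exists j.
pose U := (T :\ j)%SET.
have jU : j \notin U by rewrite !inE eqxx.
have TE : (j |: U)%SET = T by rewrite finset.setD1K.
have cU : (#|U| + i.+2 = n.+1)%N.
  by have := cardsD1 j T; rewrite jT -/U; lia.
have U0 : zigzag i.+2 U = 0.
  by apply: IH => //; rewrite ?inE ?vT 1?eq_sym ?jv //; lia.
have [_ /esym] := zigzagP cU; rewrite U0 mul0mx => kU.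
have := mcoeff_koszul cU jU; rewrite kU TE raddf0 => /esym/sign_mulz_eq0 T0.
by rewrite (zigzag_coefE Ti) T0 raddf0.
Qed.

(** Otherwise [zigzag 1] vanishes on the ridge obtained from a facet s containing
    v by removing some j distinct from v. But the boundary of the fundamental
    cycle contains x_j z_s with coefficient 1 or -1 there. *)
Lemma zigzag_vertex_neq0 v : zigzag n [set v]%SET != 0.
Proof.
apply/eqP => v0.
have [s sD vs] := pm_cover Delta v.
pose f := enum_rank_in sD s.
have fE : facet f = s by rewrite /facet enum_rankK_in.
have [j js jv] : exists2 j, j \in s & j != v.
  have : (0 < #|(s :\ v)%SET|)%N.
    by have := cardsD1 v s; rewrite vs (pm_card sD); lia.
  by case/card_gt0P => j; rewrite !inE => /andP[? ?]; exists j.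
pose U := (s :\ j)%SET.
have jU : j \notin U by rewrite !inE eqxx.
have UE : (j |: U)%SET = s by rewrite finset.setD1K.
have cU : (#|U| + 1 = n.+1)%N.
  by have := cardsD1 j s; rewrite js (pm_card sD) -/U; lia.
have U0 : zigzag 1 U = 0.
  by apply: (zigzag_vanish v0) => //; rewrite !inE vs eq_sym jv.
have [_ /esym] := zigzagP cU; rewrite U0 mul0mx koszul_cycle.
have b0 : 'I_(fr_rank G 0) by rewrite (mr_rank0 resG); apply: ord0.
move=> /rowP/(_ b0); rewrite !mxE => B0.
(* This point, x_j = z_s = 1 and 0 elsewhere, detects the monomial x_j z_s. *)
pose pt (i : 'I_q) : k := match fintype.split i with inl l => (l == j)%:R | inr s' => (s' == f)%:R end.
have ptx l : meval pt (x l) = (l == j)%:R by rewrite mevalXU /pt (unsplitK (inl l)).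
have ptz l : meval pt (@facet_var n d Delta k l) = (l == f)%:R by rewrite mevalXU /pt (unsplitK (inr l)).
have := congr1 (meval pt) B0; rewrite meval0 /cycle_boundary raddf_sum (bigD1 j) //=.
rewrite big1 ?addr0 => [|l /andP[_ /negPf lj]]; last first.
  by rewrite raddfMz /= mevalM ptx lj mul0r mul0rz.
rewrite raddfMz /= mevalM ptx eqxx mul1r => /sign_mulz_eq0.
rewrite /fundamental_cycle raddf_sum (bigD1 f) ?fE ?UE //= big1 ?addr0 => [|l /andP[_ /negPf lf]]; last first.
  by rewrite raddfMz /= ptz lf mul0rz.
rewrite raddfMz /= ptz eqxx => /sign_mulz_eq0 /eqP; by rewrite oner_eq0.
Qed.

Lemma vertex_card (v : 'I_d) : (#|[set v]%SET| + n.-1.+1 = n.+1)%N.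
Proof. by rewrite cards1 prednK. Qed.

Lemma zigzag_coef_vertex_neq0 v : zigzag_coef n [set v]%SET != 0.
Proof.
apply: contra (zigzag_vertex_neq0 v) => /eqP v0; apply/eqP.
have := zigzag_coefE (vertex_card v); rewrite (prednK n_gt0) => ->.
by rewrite v0 raddf0.
Qed.

Lemma zigzag_coef_vertex_deg v b : zigzag_coef n [set v]%SET ord0 b != 0 ->
  fr_deg b = n.+1 /\ mu n b = residual [set v]%SET.
Proof.
move: b; have := fun b => @zigzag_coef_deg n.-1 [set v]%SET b (vertex_card v).
by rewrite (prednK n_gt0).
Qed.

(** These vectors are nonzero, with supports in distinct multidegrees. *)
Lemma zigzag_coef_vertex_free : free [tuple zigzag_coef n [set v]%SET | v < d].
Proof.
apply/freeP => c c0 v.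
have /rV0Pn[b vb] := zigzag_coef_vertex_neq0 v.
move/rowP/(_ b): c0; rewrite summxE (bigD1 v) //= big1 ?addr0 => [|w wv].
  have z0 : (0 : 'rV[k]_(fr_rank G n)) ord0 b = 0 by rewrite mxE.
  rewrite nth_mktuple mxE z0 => /eqP.
  by rewrite mulf_eq0 (negPf vb) orbF => /eqP.
rewrite mxE nth_mktuple.
have [->|wb] := eqVneq (zigzag_coef n [set w]%SET ord0 b) 0; first by rewrite mulr0.
have [_ bw] := zigzag_coef_vertex_deg wb; have [_] := zigzag_coef_vertex_deg vb.
rewrite bw => /matrixP/(_ (lift ord0 w) ord0); rewrite !mxE liftK !inE eqxx.
by rewrite (negPf wv).
Qed.

Lemma strandP i (f : 'rV[k]_(fr_rank G i)) :
  (forall b, f ord0 b != 0 -> fr_deg b = i.+1) -> f \in strand G i.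
Proof.
move=> fdeg; rewrite [f]row_sum_delta; apply: rpred_sum => b _.
have [->|fb] := eqVneq (f ord0 b) 0; first by rewrite scale0r mem0v.
apply: memvZ; apply: subvP (memv_line _).
by apply: (sumv_sup b) => //; apply/eqP/fdeg.
Qed.

Lemma koszul_top u : map_mx (mcoeff u) (koszul x (zigzag n) finset.set0) =
  \sum_j ((mnm1 (lshift N j) == u)%:R *: zigzag_coef n [set j]%SET).
Proof.
have := @mcoeff_koszul_sum n.-1 finset.set0 u; rewrite cards0 prednK // => -> //.
apply: eq_big => [j|j _]; first by rewrite inE.
have j0 : #|[set i in (finset.set0 : {set 'I_d}) | (i < j)%N]%SET| = 0%N.
  by apply: eq_card0 => i; rewrite !inE.
by rewrite finset.setU0 /koszul_sign j0 expr0.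
Qed.

Lemma koszul_top_vertex v :
  map_mx (mcoeff (mnm1 (lshift N v))) (koszul x (zigzag n) finset.set0) =
  zigzag_coef n [set v]%SET.
Proof.
rewrite koszul_top (bigD1 v) //= eqxx scale1r big1 ?addr0 // => j /negPf jv.
by rewrite eq_mnm1 (inj_eq (@lshift_inj _ _)) jv scale0r.
Qed.

Definition syzygy : 'rV[k]_(fr_rank G n.+1) := zigzag_coef n.+1 finset.set0.

Lemma set0_card : (#|@finset.set0 'I_d| + n.+1 = n.+1)%N.
Proof. by rewrite cards0. Qed.

Lemma strand_diff_syzygy : strand_diff syzygy = koszul x (zigzag n) finset.set0.
Proof.
rewrite /strand_diff -zigzag_coefE ?set0_card //.
by have [_] := zigzagP set0_card.
Qed.

Lemma syzygy_neq0 : syzygy != 0.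
Proof.
apply/eqP => s0.
have v : 'I_d := Ordinal (leq_ltn_trans (leq0n n) (pm_dim_lt Delta)).
have := zigzag_coef_vertex_neq0 v; rewrite -koszul_top_vertex -strand_diff_syzygy.
by rewrite s0 /strand_diff raddf0 mul0mx raddf0 eqxx.
Qed.

Lemma syzygy_has_rank : syzygy_rank syzygy d.
Proof.
pose X := [tuple zigzag_coef n [set v]%SET | v < d].
have inX v : zigzag_coef n [set v]%SET \in X by apply: map_f; rewrite mem_enum.
exists <<X>>%VS; split=> [|u|W' _ W'f|].
- apply/span_subvP => _ /mapP[v _ ->]; apply: strandP => b.
  by case/zigzag_coef_vertex_deg.
- rewrite strand_diff_syzygy koszul_top; apply: rpred_sum => j _.
  by apply: memvZ; apply: memv_span.
- apply/span_subvP => _ /mapP[v _ ->].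
  by have := W'f (mnm1 (lshift N v)); rewrite strand_diff_syzygy koszul_top_vertex.
by have /eqP -> := zigzag_coef_vertex_free; rewrite size_tuple.
Qed.

Lemma syzygy_linear : linear_syzygy syzygy.
Proof.
split; first exact: syzygy_neq0.
by apply: strandP => b /(zigzag_coef_deg set0_card)[].
Qed.

Lemma syzygy_multidegree : has_multidegree syzygy (residual finset.set0).
Proof. by move=> b /(zigzag_coef_deg set0_card)[]. Qed.

End Zigzag.

Theorem pseudomanifold_linear_syzygy n d (Delta : oriented_pseudomanifold n d)
    (k : fieldType) : (0 < n)%N ->
  has_linear_syzygy k (exponent_mx (generator (Delta := Delta))) n d (residual finset.set0).
Proof.
move=> n0; split.
  exists (resolution k (@generator_weight1 n d Delta)).
  exact: resolution_minimal.
move=> G resG; exists (@syzygy n d Delta k G); split.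
- exact: syzygy_linear.
- exact: syzygy_has_rank.
- exact: syzygy_multidegree.
Qed.

(** * The homotopy type of the degree complex *)

Lemma continuous_mx (T U : topologicalType) m n (f : T -> 'M[U]_(m, n)) :
  (forall i j, continuous (fun x => f x i j)) -> continuous f.
Proof.
move=> cf x B [P nP sPB].
have : \forall y \near x, forall i j, P i j (f y i j).
  apply: filter_forall => i; apply: filter_forall => j.
  exact: (cf i j x (P i j) (nP i j)).
by apply: filterS => y Py; apply: sPB.
Qed.

Section DegreeComplex.
Variables (n d : nat) (Delta : oriented_pseudomanifold n d).
Local Notation N := #|pm_facets Delta|.
Local Notation e := (generator (Delta := Delta)).
Local Notation A := (exponent_mx e).
Local Notation q := (d + N)%N.

(** The facet s together with the apex z_s of the cone over it. *)
Definition star (s : 'I_N) : {set 'I_q} :=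
  (rshift d s |: [set lshift N i | i in facet s])%SET.

Lemma lshift_star i s : (lshift N i \in star s) = (i \in facet s).
Proof. by rewrite !inE eq_lrshift /= (mem_imset _ _ (@lshift_inj _ _)). Qed.

Lemma rshift_star s' s : (rshift d s' \in star s) = (s' == s).
Proof.
rewrite !inE (inj_eq (@rshift_inj _ _)); have [//|_] /= := eqVneq s' s.
by apply/negP => /imsetP[i _ /eqP]; rewrite eq_rlshift.
Qed.

Definition mnm_set (B : {set 'I_q}) : multinom q :=
  Multinom [tuple (j \in B : nat) | j < q].

Lemma mono_multidegree_set B :
  mono_multidegree A (mnm_set B) = \sum_(j in B) col j A.
Proof.
apply/matrixP => a b; rewrite !ord1 mono_multidegreeE mnmE summxE.
rewrite [RHS]big_mkcond (raddf_sum Posz); apply: eq_bigr => j _ /=.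
by rewrite mnmE; case: (j \in B); rewrite ?mul1n ?mul0n // !mxE.
Qed.

Lemma mono_image0 v : mono_image e v ord0 = (\sum_s v (rshift d s))%N.
Proof.
rewrite mnmE big_split_ord /= big1 ?add0n => [|i _]; last by rewrite generator_l0 muln0.
by apply: eq_bigr => s _; rewrite generator_r0 muln1.
Qed.

Lemma mono_imageS v i : mono_image e v (lift ord0 i) =
  (v (lshift N i) + \sum_(s | i \notin facet s) v (rshift d s))%N.
Proof.
rewrite mnmE big_split_ord /=; congr (_ + _)%N.
  rewrite (bigD1 i) //= generator_lS eqxx muln1 big1 ?addn0 // => j /negPf ji.
  by rewrite generator_lS ji muln0.
rewrite [RHS]big_mkcond; apply: eq_bigr => s _; rewrite generator_rS.
by case: (_ \notin _); rewrite ?muln1 ?muln0.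
Qed.

Lemma residual0E v : mono_multidegree A v = residual finset.set0 <->
  forall a, mono_image e v a = 1%N.
Proof.
have r1 a : residual (@finset.set0 'I_d) a ord0 = 1.
  by rewrite mxE; case: unliftP => [i|] _; rewrite ?inE.
split=> [vE a|vE].
  by have := mono_multidegreeE e v a; rewrite vE r1 => -[].
by apply/matrixP => a b; rewrite ord1 mono_multidegreeE vE r1.
Qed.

Lemma mono_image_star s : mono_multidegree A (mnm_set (star s)) = residual finset.set0.
Proof.
apply/residual0E => a; case: (unliftP ord0 a) => [i|] ->.
  rewrite mono_imageS mnmE lshift_star.
  have -> : (\sum_(s' | i \notin facet s') mnm_set (star s) (rshift d s') =
             (i \notin facet s))%N.
    rewrite big_mkcond (bigD1 s) //= mnmE rshift_star eqxx big1 ?addn0 => [|s' /negPf s's].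
      by case: (_ \notin _).
    by rewrite mnmE rshift_star s's if_same.
  by case: (_ \in _).
rewrite mono_image0 (bigD1 s) //= mnmE rshift_star eqxx big1 // => s' /negPf s's.
by rewrite mnmE rshift_star s's.
Qed.

(** The monomials of the all-ones degree are the products of z_s with the
    vertex variables of the facet s. *)
Lemma degree_complexP J :
  degree_complex A (residual finset.set0) J <-> exists s, J \subset star s.
Proof.
split=> [[u _ /eqP]|[s Js]]; last first.
  exists (mnm_set (star s :\: J)%SET) => //.
  rewrite -(mono_image_star s) !mono_multidegree_set [X in _ = X - _](big_setID J) /=.
  by rewrite (finset.setIidPr Js) addrC addrK.
rewrite eq_sym subr_eq -mono_multidegree_set -mono_multidegreeD => /eqP/esym/residual0E.
set v := mnm_add _ _ => vE.
have vJ j : j \in J -> v j != 0%N by move=> jJ; rewrite mnmDE [mnm_set _ _]mnmE jJ addn1.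
clearbody v; have := vE ord0; rewrite mono_image0 => v1.
have [s vs] : exists s, v (rshift d s) != 0%N.
  apply: contrapT => /forallNP v0; move: v1; rewrite big1 // => s _.
  by apply: contrapT => /eqP; apply: v0.
have s_unique s' : v (rshift d s') != 0%N -> s' = s.
  move=> vs'; apply: contrapT => /eqP s's; move: v1.
  rewrite (bigD1 s) //= (bigD1 s') //= => v1.
  move: v1; case: (v (rshift d s)) vs => // a _; case: (v (rshift d s')) vs' => // b _.
  by rewrite addSn addnS.
exists s; apply/fintype.subsetP => j /vJ; rewrite -[j]splitK; case: (fintype.split j) => [i|s'] /=.
  rewrite lshift_star => vi; apply: contrapT => /negP si.
  have := vE (lift ord0 i); rewrite mono_imageS (bigD1 s) //=.
  case: (v (lshift N i)) vi => // a _; case: (v (rshift d s)) vs => // b _.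
  by rewrite addSn addnS.
by rewrite rshift_star => /s_unique ->.
Qed.

Variable R : realType.
Local Notation big_space := (realization R (degree_complex A (residual finset.set0))).
Local Notation small_space := (realization R (pm_complex Delta)).

Lemma big_spaceP x : big_space x <->
  [/\ forall j, 0 <= x ord0 j, \sum_j x ord0 j = 1
    & exists s, forall j, x ord0 j != 0 -> j \in star s].
Proof.
split=> -[x0 x1].
  case/degree_complexP => s /fintype.subsetP xs; split=> //; exists s => j xj.
  by apply: xs; rewrite inE.
case=> s xs; split=> //; apply/degree_complexP; exists s.
by apply/fintype.subsetP => j; rewrite inE; apply: xs.
Qed.

Lemma small_spaceP y : small_space y <->
  [/\ forall i, 0 <= y ord0 i, \sum_i y ord0 i = 1
    & exists s : 'I_N, forall i, y ord0 i != 0 -> i \in facet s].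
Proof.
split=> -[y0 y1].
  case=> t tD /fintype.subsetP yt; split=> //; exists (enum_rank_in tD t) => i yi.
  by rewrite /facet enum_rankK_in //; apply: yt; rewrite inE.
case=> s ys; split=> //; exists (facet s); first exact: facetP.
by apply/fintype.subsetP => i; rewrite inE; apply: ys.
Qed.

(** The retraction spreads the weight of the cone point z_s uniformly over the
    vertices of s. *)
Definition spread (x : 'rV[R]_q) : 'rV[R]_d :=
  \row_i (x ord0 (lshift N i) +
          \sum_(s | i \in facet s) x ord0 (rshift d s) / n.+1%:R).

Definition extend0 (y : 'rV[R]_d) : 'rV[R]_q :=
  \row_j (if fintype.split j is inl i then y ord0 i else 0).

Lemma extend0_l y i : extend0 y ord0 (lshift N i) = y ord0 i.
Proof. by rewrite mxE (unsplitK (inl i)). Qed.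

Lemma extend0_r y s : extend0 y ord0 (rshift d s) = 0.
Proof. by rewrite mxE (unsplitK (inr s)). Qed.

Lemma sum_extend0 y : \sum_j extend0 y ord0 j = \sum_i y ord0 i.
Proof.
rewrite big_split_ord /= [X in _ + X]big1 ?addr0 => [|s _]; last exact: extend0_r.
by apply: eq_bigr => i _; rewrite extend0_l.
Qed.

Lemma sum_spread x : \sum_i spread x ord0 i = \sum_j x ord0 j.
Proof.
under eq_bigr do rewrite mxE.
rewrite big_split big_split_ord /=; congr (_ + _).
under eq_bigr do rewrite big_mkcond.
rewrite exchange_big; apply: eq_bigr => s _ /=.
by rewrite -big_mkcond sumr_const card_facet -[LHS]mulr_natr divfK.
Qed.

Lemma spread_extend0 y : spread (extend0 y) = y.
Proof.
apply/rowP => i; rewrite mxE extend0_l big1 ?addr0 // => s _.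
by rewrite extend0_r mul0r.
Qed.

Lemma spread_ge0 (x : 'rV[R]_q) : (forall j, 0 <= x ord0 j) -> forall i, 0 <= spread x ord0 i.
Proof.
move=> x0 i; rewrite mxE addr_ge0 ?sumr_ge0 // => s _.
by rewrite divr_ge0 ?ler0n.
Qed.

Lemma spread_support (x : 'rV[R]_q) (s : 'I_N) : (forall j, x ord0 j != 0 -> j \in star s) ->
  forall i, spread x ord0 i != 0 -> i \in facet s.
Proof.
move=> xs i; apply: contraR => si; rewrite mxE.
have -> : x ord0 (lshift N i) = 0.
  by apply/eqP; apply: contraR si => /xs; rewrite lshift_star.
rewrite add0r big1 // => s' is'.
suff -> : x ord0 (rshift d s') = 0 by rewrite mul0r.
apply/eqP; apply: contraR si => /xs; rewrite rshift_star => /eqP <-.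
exact: is'.
Qed.

Lemma extend0_support (y : 'rV[R]_d) (s : 'I_N) : (forall i, y ord0 i != 0 -> i \in facet s) ->
  forall j, extend0 y ord0 j != 0 -> j \in star s.
Proof.
move=> ys j; rewrite -[j]splitK; case: (fintype.split j) => [i|s'] /=.
  by rewrite extend0_l lshift_star; apply: ys.
by rewrite extend0_r eqxx.
Qed.

Lemma extend0_ge0 (y : 'rV[R]_d) : (forall i, 0 <= y ord0 i) -> forall j, 0 <= extend0 y ord0 j.
Proof. by move=> y0 j; rewrite mxE; case: fintype.split. Qed.

Lemma spread_small x : big_space x -> small_space (spread x).
Proof.
case/big_spaceP => x0 x1 [s xs]; apply/small_spaceP; split.
- exact: spread_ge0.
- by rewrite sum_spread.
- by exists s; apply: spread_support.
Qed.

Lemma extend0_big y : small_space y -> big_space (extend0 y).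
Proof.
case/small_spaceP => y0 y1 [s ys]; apply/big_spaceP; split.
- exact: extend0_ge0.
- by rewrite sum_extend0.
- by exists s; apply: extend0_support.
Qed.

Lemma continuous_add (T : topologicalType) (f g : T -> R) :
  continuous f -> continuous g -> continuous (fun x => f x + g x).
Proof. by move=> cf cg x; apply: cvgD; [apply: cf | apply: cg]. Qed.

Lemma continuous_mul (T : topologicalType) (f g : T -> R) :
  continuous f -> continuous g -> continuous (fun x => f x * g x).
Proof. by move=> cf cg x; apply: cvgM; [apply: cf | apply: cg]. Qed.

Lemma continuous_const (T : topologicalType) (a : R) : continuous (fun _ : T => a).
Proof. by move=> x; apply: cvg_cst. Qed.

Lemma continuous_coord r (j : 'I_r) : continuous (fun x : 'rV[R]_r => x ord0 j).
Proof. exact: coord_continuous. Qed.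

Lemma continuous_sum (T : topologicalType) (I : Type) (r : seq I) (P : pred I)
    (F : I -> T -> R) :
  (forall i, continuous (F i)) -> continuous (fun x => \sum_(i <- r | P i) F i x).
Proof.
by move=> cF; apply: continuous_big => //; apply: add_continuous.
Qed.

Lemma continuous_spread : continuous spread.
Proof.
apply: continuous_mx => a i; rewrite ord1.
have -> : (fun x => spread x ord0 i) = (fun x : 'rV[R]_q => x ord0 (lshift N i) +
    \sum_(s | i \in facet s) x ord0 (rshift d s) / n.+1%:R).
  by apply/funext => x; rewrite mxE.
apply: continuous_add; first exact: continuous_coord.
apply: continuous_sum => s; apply: continuous_mul; first exact: continuous_coord.
exact: continuous_const.
Qed.

Lemma continuous_extend0 : continuous extend0.
Proof.
apply: continuous_mx => a j; rewrite ord1 -[j]splitK.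
case: (fintype.split j) => [i|s] /=.
  have -> : (fun y => extend0 y ord0 (lshift N i)) = (fun y : 'rV[R]_d => y ord0 i).
    by apply/funext => y; rewrite extend0_l.
  exact: continuous_coord.
have -> : (fun y => extend0 y ord0 (rshift d s)) = fun=> 0.
  by apply/funext => y; rewrite extend0_r.
exact: continuous_const.
Qed.

Lemma continuous_segment r (h : 'rV[R]_r -> 'rV[R]_r) : continuous h ->
  continuous (fun p : R * 'rV[R]_r => (1 - p.1) *: h p.2 + p.1 *: p.2).
Proof.
move=> ch; apply: continuous_mx => a i; rewrite ord1.
have -> : (fun p : R * 'rV[R]_r => ((1 - p.1) *: h p.2 + p.1 *: p.2) ord0 i) =
          (fun p => (1 + (-1) * p.1) * h p.2 ord0 i + p.1 * p.2 ord0 i).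
  by apply/funext => p; rewrite !mxE mulN1r.
have c1 : continuous (fun p : R * 'rV[R]_r => p.1) by move=> p; apply: cvg_fst.
have c2 : continuous (fun p : R * 'rV[R]_r => p.2) by move=> p; apply: cvg_snd.
have c2i : continuous (fun p : R * 'rV[R]_r => p.2 ord0 i).
  move=> p; exact: (continuous_comp (c2 p) (@continuous_coord r i p.2)).
have chi : continuous (fun p : R * 'rV[R]_r => h p.2 ord0 i).
  move=> p.
  exact: (continuous_comp (continuous_comp (c2 p) (ch p.2)) (@continuous_coord r i (h p.2))).
apply: continuous_add; apply: continuous_mul => //.
apply: continuous_add; first exact: continuous_const.
by apply: continuous_mul => //; apply: continuous_const.
Qed.

(** [extend0] is a section of [spread], and the segment from x to
    [extend0 (spread x)] stays in any simplex [star s] containing x. *)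
Lemma degree_complex_homotopy_equivalent :
  complexes_homotopy_equivalent R (degree_complex A (residual finset.set0))
    (pm_complex Delta).
Proof.
exists spread, extend0; split.
- by split; [exact/continuous_subspaceT/continuous_spread | exact: spread_small].
- by split; [exact/continuous_subspaceT/continuous_extend0 | exact: extend0_big].
- exists (fun p => (1 - p.1) *: (extend0 \o spread) p.2 + p.1 *: p.2); split.
  + apply/continuous_subspaceT/continuous_segment => x.
    exact: (continuous_comp (@continuous_spread x) (@continuous_extend0 (spread x))).
  + move=> t x /=; rewrite in_itv /= => /andP[t0 t1] /big_spaceP[x0 x1 [s xs]].
    apply/big_spaceP; split=> [j||].
    * by rewrite !mxE addr_ge0 ?mulr_ge0 ?subr_ge0 // -[fintype.split j]/(fintype.split j);
        have := extend0_ge0 (spread_ge0 x0) j; rewrite mxE.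
    * under eq_bigr do rewrite mxE [X in X + _]mxE [X in _ + X]mxE.
      rewrite big_split /= -!mulr_sumr sum_extend0 sum_spread x1 !mulr1.
      by rewrite subrK.
    * exists s => j; apply: contraR => js.
      have jx : x ord0 j = 0 by apply/eqP; apply: contraR js => /xs.
      have je : extend0 (spread x) ord0 j = 0.
        by apply/eqP; apply: contraR js => /(extend0_support (spread_support xs)).
      by rewrite mxE [X in X + _]mxE [X in _ + X]mxE jx je !mulr0 addr0.
  + by move=> x _ /=; rewrite subr0 scale1r scale0r addr0.
  + by move=> x _ /=; rewrite subrr scale0r scale1r add0r.
exists snd; split=> //.
- by apply: continuous_subspaceT => x; apply: cvg_snd.
- by move=> y _ /=; rewrite spread_extend0.
Qed.

End DegreeComplex.

Theorem theorem1p8 (k : closedFieldType) (hk : [pchar k] =i pred0)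
    (R : realType) (n d : nat) (hn : (0 < n)%N)
    (Delta : oriented_pseudomanifold n d) :
  exists (p q : nat) (A : 'M[int]_(p, q)) (m : 'cV[int]_p),
    [/\ injective (fun j => col j A),
        homogeneous_ideal (toric_ideal A k),
        proj_dimension (proj_zeros (toric_ideal A k)) d,
        has_linear_syzygy k A n d m
      & complexes_homotopy_equivalent R (degree_complex A m)
          (pm_complex Delta)].
Proof.
exists d.+1, (d + #|pm_facets Delta|)%N, (exponent_mx (generator (Delta := Delta))).
exists (residual finset.set0); split.
- exact: generator_col_inj.
- exact: toric_ideal_homogeneous (@generator_weight1 n d Delta).
- exact: toric_dimension.
- exact: pseudomanifold_linear_syzygy.
exact: degree_complex_homotopy_equivalent.
Qed.
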